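(* Let $0<\alpha<1$ and let $\{B(t):t\in[0,1]\}$ be a fractional Brownian motion of Hurst index $\alpha$. Then, almost surely, for all $A\subset[0,1]$: (1) if $B|_A\in C^{\beta}(A)$ for some $\beta>\alpha$, then $\overline{\dim}_{\mathcal M}A\le1-\alpha$; (2) if $V^{\beta}(B|_A)<\infty$ for some $\beta>0$, then $\overline{\dim}_{\mathcal M}A\le\max\{1-\alpha,\alpha\beta\}$.
   Context: A process $\{B(t):t\ge0\}$ is a fractional Brownian motion of Hurst index $\alpha\in(0,1)$ if $B$ is a Gaussian process with stationary increments, $B(0)=0$, $t^{-\alpha}B(t)$ is standard normal for every $t>0$, and almost surely $t\mapsto B(t)$ is continuous; its covariance is $\mathbb E(B(t)B(s))=\frac12(|t|^{2\alpha}+|s|^{2\alpha}-|t-s|^{2\alpha})$. Here it is restricted to $[0,1]$. For non-empty $A\subset[0,1]$ and $\beta>0$, $C^{\beta}(A)$ is the set of $\beta$-Hölder continuous functions $f\colon A\to\mathbb R$, i.e. those for which there is $c\in(0,\infty)$ with $|f(x)-f(y)|\le c|x-y|^{\beta}$ for all $x,y\in A$. The $\beta$-variation of $f\colon A\to\mathbb R$ is \[ V^{\beta}(f)=\sup\left\{\sum_{i=1}^{n}|f(x_i)-f(x_{i-1})|^{\beta}:\ x_0<\dots<x_n,\ x_i\in A,\ n\in\mathbb N^+\right\}. \] $\overline{\dim}_{\mathcal M}$ is the upper Minkowski (upper box) dimension: for an integer $M\ge2$, $\overline{\dim}_{\mathcal M}A=\limsup_{n\to\infty}\frac{\log N_n(A,M)}{n\log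 M}$, where $N_n(A,M)$ is the number of intervals $[pM^{-n},(p+1)M^{-n})$, $p\in\{0,\dots,M^n-1\}$, that intersect $A$ (the value does not depend on $M$). *)

(* Defs.v *)
From HB Require Import structures.
From mathcomp Require Export all_boot all_order all_algebra.
From mathcomp Require Export all_classical all_reals all_analysis.
Export numFieldNormedType.Exports.

Set Implicit Arguments.
Unset Strict Implicit.
Unset Printing Implicit Defensive.

Import Order.TTheory GRing.Theory Num.Theory.

Local Open Scope classical_set_scope.
Local Open Scope ring_scope.

(* Laws are compared on measurable sets only: [normal_prob] is an integral and
   has no meaning on the other ones. *)
Definition eq_law (R : realType) (mu nu : set R -> \bar R) : Prop :=
  forall V : set R, measurable V -> mu V = nu V.

(* [normal_prob m 0] is not the point mass at [m] but the uniform law on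
   [0, 1], hence the separate degenerate case. *)
Definition gaussian_law (R : realType) (mu : set R -> \bar R) : Prop :=
  exists m s : R,
    [\/ s = 0 /\ eq_law mu (dirac m) | 0 < s /\ eq_law mu (normal_prob m s)].

(* The finite-dimensional marginals of [B] with times in [D] are jointly
   Gaussian: all their linear combinations are (possibly degenerate) Gaussian. *)
Definition gaussian_process (d : measure_display) (T : measurableType d)
    (R : realType) (P : probability T R) (D : set R) (B : R -> {RV P >-> R}) :
    Prop :=
  forall (n : nat) (t c : 'I_n -> R), (forall i, D (t i)) ->
    gaussian_law (pushforward P (fun w => \sum_(i < n) c i * B (t i) w)).

Definition stationary_increments (d : measure_display) (T : measurableType d)
    (R : realType) (P : probability T R) (D : set R) (B : R -> {RV P >-> R}) :
    Prop :=
  forall s t h : R, D s -> D t -> D (s + h) -> D (t + h) ->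
    eq_law (pushforward P (fun w => B (t + h) w - B (s + h) w))
           (pushforward P (fun w => B t w - B s w)).

(* The time set is [D] (here [0, 1], or [0, +oo[ for the full process); the
   values of [B] outside [D] are irrelevant. *)
Definition fractional_brownian_motion (d : measure_display)
    (T : measurableType d) (R : realType) (P : probability T R) (D : set R)
    (alpha : R) (B : R -> {RV P >-> R}) : Prop :=
  [/\ gaussian_process D B,
      stationary_increments D B,
      {ae P, forall w, B 0 w = 0},
      forall t : R, D t -> 0 < t ->
        eq_law (pushforward P (fun w => t `^ (- alpha) * B t w))
               (normal_prob 0 1) &
      {ae P, forall w, {within D, continuous (fun t => B t w)}}].

Definition holder_on (R : realType) (beta : R) (A : set R) (f : R -> R) :
    Prop :=
  exists2 c : R, 0 < c &
    forall x y : R, A x -> A y -> `|f x - f y| <= c * `|x - y| `^ beta.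

(* If [A] has at most one point, this is [ereal_sup set0 = -oo]; only its
   finiteness from above is meaningful in that case. *)
Definition power_variation (R : realType) (beta : R) (A : set R) (f : R -> R) :
    \bar R :=
  ereal_sup [set v : \bar R | exists (n : nat) (x : nat -> R),
    [/\ (0 < n)%N,
        forall i, (i < n)%N -> x i < x i.+1,
        forall i, (i <= n)%N -> A (x i) &
        v = (\sum_(1 <= i < n.+1) `|f (x i) - f (x i.-1)| `^ beta)%:E]].

Definition mesh_interval (R : realType) (M n p : nat) : set R :=
  [set x | p%:R / (M ^ n)%:R <= x < p.+1%:R / (M ^ n)%:R].

Definition mesh_count (R : realType) (M n : nat) (A : set R) : nat :=
  #|[pred p : 'I_(M ^ n) | `[< @mesh_interval R M n p `&` A !=set0 >]]|.

(* [ln 0 = 0]: a set which meets no mesh interval (the empty set and {1})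
   has dimension 0. *)
Definition upper_minkowski_dim (R : realType) (M : nat) (A : set R) : \bar R :=
  limn_esup (fun n : nat =>
    (ln (mesh_count M n A)%:R / (n%:R * ln M%:R))%:E).

(* Main.v *)
From HB Require Import structures.
Require Import Defs.
From mathcomp Require Import ring lra zify measurable_realfun.

(** Fix an almost every path [f] of the process. For a set [A], compare the number
    [N n] of intervals of length [M ^- n] that meet [A] at two scales [n] and
    [k = n - j], with [j] a small fraction of [n]. Call an interval of level [k]
    oscillating if [f] varies by more than [M ^- (n alpha)] on the part of [A] inside
    it. In an interval that is not oscillating, the intervals of level [n] that
    meet [A] are times at which [f] is back near one fixed value. The path is not
    expected to do so more than [M ^ (j (1 - alpha))] times, hence up to factors
    [M ^ (eps n)]

      N n <= 2 M ^ (j (1 - alpha)) N k + M ^ j #{oscillating intervals of level k}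

    ([mesh_count_recursion]). If the restriction of [f] to [A] is Hoelder of exponent
    above [alpha], no interval oscillates ([holder_no_oscillation]). If it has finite
    [beta]-variation, at most a constant times [M ^ (n alpha beta)] of them do, since
    each contributes to the variation ([variation_oscillation]). Iterating the
    recursion ([growth_bound]) gives both claims ([dimension_bound]).

    Two almost sure properties of the path are needed, at all large scales and all
    positions at once. One is the size of the increments along the grid
    ([fbm_grid_increments]), from Gaussian tails. The other is the bound on the
    number of returns ([fbm_returns]). For the latter, a number [Z] of returns
    produces [binomial(Z, p)] increasing chains of [p] return times, and the
    expected number of chains is at most the [p]-th power of a sum over one gap;
    taking [p] large leaves room for a union bound and the Borel-Cantelli lemma.

    The probability that a given chain consists of returns is at most the product
    over its gaps [g] of a constant times [r / g ^ alpha] ([fbm_small_ball]). It is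
    obtained by dominating the indicator with a product of trigonometric kernels
    and summing the characteristic function of the Gaussian vector over a lattice,
    one coordinate at a time ([small_ball], [sum_gaussian_freqs]); what is needed is
    a lower bound on the variance of each value given the past. This local
    nondeterminism ([local_nondeterminism]) follows from the moving-average
    representation: the covariance is that of the kernels [(s + x)_+ ^ (alpha - 1/2)]
    in [L2], and near the end of its support the kernel of the latest time is the
    only one that does not vanish. *)

Set Implicit Arguments.
Unset Strict Implicit.
Unset Printing Implicit Defensive.

Import Order.TTheory GRing.Theory Num.Theory.

Local Open Scope classical_set_scope.
Local Open Scope ring_scope.

(** * Affine changes of variables *)

Lemma lebesgue_measure_affine (R : realType) (a b : R) (A : set R) :
  0 < a -> measurable A ->
  (@lebesgue_measure R A =
   a%:E * @lebesgue_measure R ((fun x => (a * x + b)%R) @^-1` A))%E.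
Proof.
move=> a0 mA.
pose phi (x : measurableTypeR R) : measurableTypeR R := a * x + b.
have mphi : measurable_fun setT phi.
  apply: measurable_funD => //; exact: measurable_funM.
pose nu : {measure set (measurableTypeR R) -> \bar R} :=
  mscale (NngNum (ltW a0)) (pushforward (@lebesgue_measure R) phi).
suff H X : ocitv X -> lebesgue_measure X = nu mphi X.
  exact: (lebesgue_measure_unique H mA).
move=> [[u v] _ <-].
have E : phi @^-1` [set` `]u, v]] = [set` `](u - b) / a, (v - b) / a]].
  apply/seteqP; split => x /=; rewrite !in_itv /= ltr_pdivrMr// ler_pdivlMr//;
    rewrite ltrBlDr lerBrDr mulrC //.
transitivity (a%:E * lebesgue_measure (phi @^-1` `]u, v]))%E; last by []. rewrite E.
rewrite !lebesgue_measure_itv /= !lte_fin ltr_pM2r ?invr_gt0// ltrD2r.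
case: ifPn => _; last by rewrite mule0.
by rewrite -!EFinD -EFinM; congr EFin; field; rewrite gt_eqF.
Qed.

Lemma ge0_integral_affine (R : realType) (a b : R) (f : R -> \bar R) :
  0 < a -> measurable_fun setT f -> (forall x, (0 <= f x)%E) ->
  (\int[lebesgue_measure]_x f x =
   a%:E * \int[lebesgue_measure]_x f (a * x + b)%R)%E.
Proof.
move=> a0 mf f0.
pose phi (x : measurableTypeR R) : measurableTypeR R := a * x + b.
have mphi : measurable_fun setT phi.
  apply: measurable_funD => //; exact: measurable_funM.
pose nu : {measure set (measurableTypeR R) -> \bar R} :=
  mscale (NngNum (ltW a0)) (pushforward (@lebesgue_measure R) phi).
rewrite (@eq_measure_integral _ _ _ _ (nu mphi)); last first.
  by move=> A mA _; apply: lebesgue_measure_affine.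
rewrite /nu ge0_integral_mscale//; congr (_ * _)%E.
by rewrite ge0_integral_pushforward.
Qed.

(** * Integrals of powers *)

Lemma measurable_powRl (R : realType) (p : R) (D : set R) :
  measurable_fun D (fun x : R => (x `^ p)%:E).
Proof.
by apply/measurable_funTS/measurable_EFinP; exact: measurable_powR.
Qed.

Lemma integral_powR (R : realType) (p x y : R) : 0 < x -> x < y ->
  p + 1 != 0 ->
  (\int[lebesgue_measure]_(t in `[x, y]) (t `^ p)%:E =
   ((y `^ (p + 1) - x `^ (p + 1)) / (p + 1))%:E)%E.
Proof.
move=> x0 xy p1.
pose F (t : R) := (p + 1)^-1 * t `^ (p + 1).
have cp q (z : R) : 0 < z -> {for z, continuous (fun t : R => t `^ q)}.
  move=> z0; apply: differentiable_continuous; apply/derivable1_diffP.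
  by apply: derivable_powR; rewrite in_itv /= z0.
have dF (z : R) : 0 < z -> is_derive z 1 F (z `^ p).
  move=> z0; have h := is_derive1_powR (p + 1) z0.
  have := @is_deriveZ _ _ _ _ (p + 1)^-1 _ _ _ h.
  by rewrite -[X in is_derive _ _ _ X]/(_ * (_ * _)) mulrA mulVf// mul1r addrK.
have cF (z : R) : 0 < z -> {for z, continuous F}.
  by move=> z0; apply: differentiable_continuous; apply/derivable1_diffP; case: (dF z z0).
rewrite (@continuous_FTC2 _ _ F)//.
- by rewrite /F; congr EFin; ring.
- apply: continuous_in_subspaceT => z; rewrite inE /= in_itv /= => /andP[xz _].
  by apply: cp; apply: lt_le_trans xz.
- split.
  + by move=> z; rewrite in_itv/= => /andP[xz _]; case: (dF z (lt_trans x0 xz)).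
  + by apply: cvg_at_right_filter; apply: cF.
  + by apply: cvg_at_left_filter; apply: cF; apply: lt_trans xy.
- move=> z; rewrite in_itv/= => /andP[xz _].
  by rewrite derive1E; have [_ ->] := dF z (lt_trans x0 xz).
Qed.

Lemma integral_powR_near0 (R : realType) (p : R) : -1 < p ->
  (\int[lebesgue_measure]_(t in `]0%R, 1%R]) (t `^ p)%:E < +oo)%E.
Proof.
move=> p1.
have p10 : 0 < p + 1 by lra.
pose F n : set R := `[n.+2%:R^-1, 1]%classic.
have -> : (`]0, 1]%classic : set R) = \bigcup_n F n.
  apply/seteqP; split => x /=; rewrite ?in_itv/=.
    move=> /andP[x0 x1].
    exists (Num.truncn x^-1) => //; rewrite /F /= in_itv/= x1 andbT.
    rewrite invf_ple ?posrE//.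
    apply: ltW; apply: lt_trans (truncnS_gt _) _.
    by rewrite ltr_nat.
  move=> [n _]; rewrite /F /= in_itv/= => /andP[nx ->]; rewrite andbT.
  by apply: lt_le_trans nx; rewrite invr_gt0.
have cv := @ge0_nondecreasing_set_cvg_integral _ (measurableTypeR R) R F (fun t : R => (t `^ p)%:E) (@lebesgue_measure R).
have {cv} : (\int[lebesgue_measure]_(x in F i) (x `^ p)%:E @[i --> \oo] -->
   \int[lebesgue_measure]_(x in \bigcup_i F i) (x `^ p)%:E)%E.
  apply: cv.
  - move=> m n mn; apply/subsetPset => x; rewrite /F /= !in_itv/= => /andP[mx ->].
    by rewrite andbT (le_trans _ mx)// lef_pV2 ?posrE// ler_nat.
  - by move=> i; exact: measurable_itv.
  - by move=> i; exact: measurable_powRl.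
  - by move=> i x _; rewrite lee_fin powR_ge0.
move=> cv.
apply: (@le_lt_trans _ _ ((p + 1)^-1)%:E); last by rewrite ltry.
rewrite -(cvg_lim _ cv)//; apply: lime_le; first by apply/cvg_ex; eexists; exact: cv.
apply: nearW => n; rewrite /F integral_powR ?gt_eqF//; last first.
  by rewrite invf_lt1// ltr1n.
rewrite lee_fin ler_pdivrMr// mulVf ?gt_eqF//.
by rewrite powR1 lerBlDr lerDl powR_ge0.
Qed.

Lemma integral_powR_infty (R : realType) (p : R) : p < -1 ->
  (\int[lebesgue_measure]_(t in `[1%R, +oo[) (t `^ p)%:E < +oo)%E.
Proof.
move=> p1.
have p10 : p + 1 < 0 by lra.
pose F n : set R := `[1, n.+2%:R]%classic.
have -> : (`[1, +oo[%classic : set R) = \bigcup_n F n.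
  apply/seteqP; split => x /=; rewrite ?in_itv/= ?andbT.
    move=> x1.
    exists (Num.truncn x) => //; rewrite /F /= in_itv/= x1 /=.
    apply: ltW; apply: lt_trans (truncnS_gt _) _.
    by rewrite ltr_nat.
  by move=> [n _]; rewrite /F /= in_itv/= => /andP[].
have cv := @ge0_nondecreasing_set_cvg_integral _ (measurableTypeR R) R F (fun t : R => (t `^ p)%:E) (@lebesgue_measure R).
have {cv} : (\int[lebesgue_measure]_(x in F i) (x `^ p)%:E @[i --> \oo] -->
   \int[lebesgue_measure]_(x in \bigcup_i F i) (x `^ p)%:E)%E.
  apply: cv.
  - move=> m n mn; apply/subsetPset => x; rewrite /F /= !in_itv/= => /andP[-> mx] /=.
    by rewrite (le_trans mx)// ler_nat.
  - by move=> i; exact: measurable_itv.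
  - by move=> i; exact: measurable_powRl.
  - by move=> i x _; rewrite lee_fin powR_ge0.
move=> cv.
apply: (@le_lt_trans _ _ (- (p + 1)^-1)%:E); last by rewrite ltry.
rewrite -(cvg_lim _ cv)//; apply: lime_le; first by apply/cvg_ex; eexists; exact: cv.
apply: nearW => n; rewrite /F integral_powR ?lt_eqF// ?ltr1n//.
rewrite lee_fin ler_ndivrMr// mulNr mulVf ?lt_eqF//.
by rewrite powR1 lerBrDr addNr powR_ge0.
Qed.

(** * The moving-average kernel *)

(** The moving-average kernel of Mandelbrot and Van Ness. The case distinction is
    there because [u `^ c] is [1] for negative [u]. *)
Definition mvn (R : realType) (alpha u : R) : R :=
  if 0 < u then u `^ (alpha - 2^-1) else 0.

Lemma mvn_scale (R : realType) (alpha a u : R) : 0 < a ->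
  mvn alpha (a * u) = a `^ (alpha - 2^-1) * mvn alpha u.
Proof.
move=> a0; rewrite /mvn pmulr_rgt0//; case: ifPn => u0; last by rewrite mulr0.
by rewrite powRM// ltW.
Qed.

Lemma measurable_mvn (R : realType) (alpha x : R) :
  measurable_fun setT (fun s : R => mvn alpha (s + x)).
Proof.
apply: (@measurableT_comp _ _ _ _ _ _ (mvn alpha)).
  apply: measurable_fun_ifT => //.
  exact: (@measurable_fun_ltr _ _ _ _ (cst 0) id).
by apply: measurable_funD.
Qed.

Lemma measurable_mvn_sqr (R : realType) (alpha x y : R) (D : set R) :
  measurable_fun D
    (fun s : R => ((mvn alpha (s + x) - mvn alpha (s + y)) ^+ 2)%:E).
Proof.
apply/measurable_funTS/measurable_EFinP/measurable_funX.
by apply: measurable_funB; exact: measurable_mvn.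
Qed.

(** Gains one power of [s] over either term, which makes the squared kernel
    increment integrable at infinity: there [2 * (alpha - 2^-1 - 1) < -1]. *)
Lemma powR_increment_bound (R : realType) (c s : R) : `|c| <= 1 -> 0 < s ->
  `|(s + 1) `^ c - s `^ c| <= s `^ (c - 1).
Proof.
move=> c1 s0.
have s10 : 0 < s + 1 by lra.
have -> : (s + 1) `^ c = s `^ c * (1 + s^-1) `^ c.
  rewrite -powRM ?ltW// ?addr_gt0 ?invr_gt0//; congr (_ `^ _).
  by rewrite mulrDr mulr1 divff// gt_eqF.
rewrite -[X in _ - X]mulr1 -mulrBr normrM ger0_norm ?powR_ge0//.
have -> : s `^ (c - 1) = s `^ c * s^-1.
  rewrite powRB; last by rewrite (gt_eqF s0) implybT.
  by rewrite powRr1// ltW.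
rewrite ler_pM2l ?powR_gt0//.
have : 0 < s^-1 by rewrite invr_gt0.
move: (s^-1) => u u0.
have u1 : 1 <= 1 + u by lra.
move: c1; rewrite ler_norml => /andP[c1 c2].
rewrite ler_norml; apply/andP; split.
  have : (1 + u) `^ (-1) <= (1 + u) `^ c by exact: ler_powR.
  rewrite powR_inv1; last by lra.
  suff : 1 - u <= (1 + u)^-1 by lra.
  by rewrite -[leRHS]mul1r ler_pdivlMr; nra.
have : (1 + u) `^ c <= (1 + u) `^ 1 by exact: ler_powR.
by rewrite powRr1; lra.
Qed.

(** The integrand is dominated by powers on the integrable side: of exponent
    [2 * alpha - 1 > -1] at the singularities [-1] and [0], and of exponent
    [2 * alpha - 3 < -1] at infinity. *)
Lemma mvn_unit_fin (R : realType) (alpha : R) : 0 < alpha < 1 ->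
  (\int[lebesgue_measure]_s
     ((mvn alpha (s + 1) - mvn alpha (s + 0)) ^+ 2)%:E < +oo)%E.
Proof.
move=> /andP[a0 a1].
pose c := alpha - 2^-1.
pose p := 2 * c.
have sq (u : R) : 0 < u -> (u `^ c) ^+ 2 = u `^ p.
  by move=> u0; rewrite -powR_mulrn ?powR_ge0// -powRrM mulrC.
pose f (s : R) := ((mvn alpha (s + 1) - mvn alpha (s + 0)) ^+ 2)%:E.
have f0 s : (0 <= f s)%E by rewrite lee_fin sqr_ge0.
have mf D : measurable_fun D f by exact: measurable_mvn_sqr.
have -> : [set: measurableTypeR R] =
   `]-oo, -1] `|` (`]-1, 0] `|` (`]0, 1] `|` `]1, +oo[)).
  apply/seteqP; split => // x _ /=; rewrite !in_itv/= andbT.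
  have [?|?] := lerP (x : R) (-1)%R; [by left|right].
  have [?|?] := lerP (x : R) 0%R; [by left|right].
  by have [?|?] := lerP (x : R) 1%R; [left|right].
have E1 : (\int[lebesgue_measure]_(s in `]-oo, (-1)%R]) f s = 0)%E.
  apply: integral0_eq => s; rewrite /= in_itv/= => s1.
  rewrite /f /mvn !ifN -?leNgt; [|lra|lra].
  by rewrite subrr expr0n.
have E2 : (\int[lebesgue_measure]_(s in `](-1)%R, 0%R]) f s < +oo)%E.
  rewrite (_ : (\int[_]_(s in _) _ =
     \int[lebesgue_measure]_(t in `]0%R, 1%R]) (t `^ p)%:E)%E).
    by apply: integral_powR_near0; rewrite /p /c; lra.
  rewrite integral_mkcond [RHS]integral_mkcond.
  rewrite [RHS](@ge0_integral_affine _ 1 1)//.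
  - rewrite mul1e; apply: eq_integral => s _; rewrite mul1r /patch.
    rewrite !mem_setE !in_itv/= -ltrBlDr sub0r.
    rewrite (_ : (s + 1 <= 1) = (s <= 0)); last by lra.
    case: ifP => // /andP[s1 s0].
    rewrite /f /mvn ifT ?ifN -?leNgt; [|lra|lra].
    by rewrite subr0 sq//; lra.
  - apply/measurable_restrict => //; rewrite setTI.
    exact: measurable_powRl.
  - by move=> x; apply: erestrict_ge0 => t _; rewrite lee_fin powR_ge0.
have E3 : (\int[lebesgue_measure]_(s in `]0%R, 1%R]) f s < +oo)%E.
  apply: (@le_lt_trans _ _ (\int[lebesgue_measure]_(s in `]0%R, 1%R])
     ((8 : R)%:E + 2%:E * (s `^ p)%:E))%E).
    apply: ge0_le_integral => //.
    - exact: mf.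
    - apply: (@emeasurable_funD _ _ _ _ (cst 8%:E) (fun s : R => 2%:E * (s `^ p)%:E)%E) => //.
      by apply: measurable_funeM; exact: measurable_powRl.
    - move=> s; rewrite /= in_itv/= => /andP[s0 s1].
      rewrite /f /mvn addr0 s0 ifT; last by lra.
      rewrite -EFinM -EFinD lee_fin -/c -sq//.
      have A0 : 0 <= s `^ c by apply: powR_ge0.
      have B0 : 0 <= (s + 1) `^ c by apply: powR_ge0.
      have : (s + 1) `^ c <= 2.
        have : (s + 1) `^ c <= (s + 1) `^ 1 by apply: ler_powR; rewrite /c; lra.
        by rewrite powRr1; lra.
      nra.
  rewrite ge0_integralD//; last 2 first.
  - by move=> x _; rewrite mule_ge0// lee_fin powR_ge0.
  - by apply: measurable_funeM; exact: measurable_powRl.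
  rewrite integral_cst// ge0_integralZl//; last 2 first.
  - exact: measurable_powRl.
  - by move=> x _; rewrite lee_fin powR_ge0.
  rewrite [X in (_ * X)%E]lebesgue_measure_itv/= lte_fin ltr01 oppr0 adde0 mule1 lte_add_pinfty ?ltry//.
  rewrite lte_mul_pinfty//.
  by apply: integral_powR_near0; rewrite /p /c; lra.
have E4 : (\int[lebesgue_measure]_(s in `]1%R, +oo[) f s < +oo)%E.
  apply: (@le_lt_trans _ _ (\int[lebesgue_measure]_(s in `[1%R, +oo[)
     (s `^ (p - 2))%:E)%E); last first.
    by apply: integral_powR_infty; rewrite /p /c; lra.
  apply: (@le_trans _ _ (\int[lebesgue_measure]_(s in `]1%R, +oo[)
     (s `^ (p - 2))%:E)%E).
    apply: ge0_le_integral => //.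
    - exact: mf.
    - exact: measurable_powRl.
    - move=> s; rewrite /= in_itv/= andbT => s1.
      have s0 : 0 < s by lra.
      rewrite /f /mvn addr0 s0 ifT; last by lra.
      rewrite lee_fin -/c -real_normK ?num_real//.
      have -> : s `^ (p - 2) = (s `^ (c - 1)) ^+ 2.
        rewrite -powR_mulrn ?powR_ge0// -powRrM; congr (_ `^ _).
        by rewrite /p; ring.
      rewrite ler_sqr ?nnegrE ?powR_ge0//.
      apply: powR_increment_bound => //.
      by rewrite ler_norml /c; lra.
  apply: ge0_subset_integral => //.
  - exact: measurable_powRl.
  - by move=> x _; rewrite lee_fin powR_ge0.
  - by move=> x; rewrite /= !in_itv/= !andbT => /ltW.
rewrite !ge0_integral_setU//.
all: try by apply: measurableU => //; apply: measurableU.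
all: try by move=> x _; exact: f0.
all: try exact: mf.
all: try by apply/disj_setPS => x [] /=; rewrite !in_itv/=; lra.
rewrite [X in (X + _)%E]E1 add0e.
by apply: lte_add_pinfty => //; exact: lte_add_pinfty.
Qed.

(** * Local nondeterminism *)

(** Weights of total zero kill the terms in [u i ^+ 2] and [u j ^+ 2], so that a
    second moment only depends on the second moments of the differences. It is
    used twice: for the moving-average kernels, and for the process itself. *)
Lemma sqr_sum_balanced (R : realFieldType) (n : nat) (a u : 'I_n -> R) :
  \sum_i a i = 0 ->
  (\sum_i a i * u i) ^+ 2 =
  \sum_i \sum_j (- 2^-1 * (a i * a j)) * (u i - u j) ^+ 2.
Proof.
move=> a0.
have E i : \sum_j (- 2^-1 * (a i * a j)) * (u i - u j) ^+ 2 =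
   (- 2^-1 * a i * (\sum_j a j * u j ^+ 2)) + (a i * u i) * (\sum_j a j * u j).
  rewrite !mulr_sumr -big_split /=.
  transitivity (\sum_j ((- 2^-1 * a i * u i ^+ 2) * a j +
    (- 2^-1 * a i * (a j * u j ^+ 2) + a i * u i * (a j * u j)))).
    by apply: eq_bigr => j _; field.
  by rewrite big_split /= -mulr_sumr a0 mulr0 add0r.
rewrite (eq_bigr _ (fun i _ => E i)) big_split /= -!mulr_suml.
by rewrite -mulr_sumr a0 mulr0 mul0r add0r expr2.
Qed.

Lemma integral_sqr_sum (d : measure_display) (T : measurableType d)
    (R : realType) (mu : {measure set T -> \bar R}) (n : nat)
    (f : 'I_n -> T -> R) (V : 'I_n -> 'I_n -> R) (a : 'I_n -> R) :
  (forall i, measurable_fun setT (f i)) ->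
  (forall i j, \int[mu]_w ((f i w - f j w) ^+ 2)%:E = (V i j)%:E)%E ->
  \sum_i a i = 0 ->
  (\int[mu]_w ((\sum_i a i * f i w) ^+ 2)%:E =
    (- 2^-1 * \sum_i \sum_j a i * a j * V i j)%:E)%E.
Proof.
move=> mf fV a0.
pose h (p : 'I_n * 'I_n) w : \bar R := (((f p.1 w - f p.2 w) ^+ 2)%:E)%E.
have mh p : measurable_fun setT (h p).
  by apply/measurable_EFinP/measurable_funX/measurable_funB.
have ih p : mu.-integrable setT (h p).
  apply/integrableP; split => //.
  under eq_integral do rewrite gee0_abs ?lee_fin ?sqr_ge0//.
  by rewrite fV ltry.
under eq_integral => w _.
  rewrite sqr_sum_balanced// pair_bigA /= -sumEFin.
  under eq_bigr do rewrite EFinM -/(h _ _).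
  over.
rewrite (@integral_sum _ _ _ _ _ _ _
  (fun p w => ((- 2^-1 * (a p.1 * a p.2))%:E * h p w)%E))//; last first.
  by move=> p; exact: integrableZl.
transitivity (\sum_(p : 'I_n * 'I_n)
    ((- 2^-1 * (a p.1 * a p.2)) * V p.1 p.2)%:E)%E.
  by apply: eq_bigr => p _; rewrite integralZl// fV EFinM.
rewrite sumEFin; congr EFin; rewrite pair_bigA mulr_sumr.
by apply: eq_bigr => p _; rewrite -mulrA.
Qed.

Section fractional_kernel.
Context (R : realType) (alpha : R).
Hypothesis alpha01 : 0 < alpha < 1.

Definition mvn_const : R :=
  fine (\int[lebesgue_measure]_s
     ((mvn alpha (s + 1) - mvn alpha (s + 0)) ^+ 2)%:E)%E.

(** By translation and scaling of Lebesgue measure, the kernels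
    [s |-> mvn alpha (s + x)] have the increments of a fractional Brownian motion,
    up to the constant [mvn_const]. *)
Lemma integral_mvn_increment (x y : R) :
  (\int[lebesgue_measure]_s
     ((mvn alpha (s + x) - mvn alpha (s + y)) ^+ 2)%:E =
   (mvn_const * `|x - y| `^ (2 * alpha))%:E)%E.
Proof.
have /andP[a0 a1] := alpha01.
wlog xy : x y / y <= x => [H|].
  have [yx|xy] := leP y x; first exact: H.
  rewrite distrC -H; last exact: ltW.
  by apply: eq_integral => s _; congr EFin; ring.
rewrite le_eqVlt in xy; case/orP: xy => [/eqP ->|xy].
  rewrite subrr normr0 powR0 ?mulr0; last by lra.
  by apply: integral0_eq => s _; rewrite subrr expr0n.
have r0 : 0 < x - y by lra.
rewrite (@ge0_integral_affine _ (x - y) (- y))//; first last.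
- by move=> s; rewrite lee_fin sqr_ge0.
- exact: measurable_mvn_sqr.
under eq_integral => s _.
  rewrite (_ : (x - y) * s + - y + x = (x - y) * (s + 1)); last by ring.
  rewrite (_ : (x - y) * s + - y + y = (x - y) * (s + 0)); last by ring.
  rewrite !mvn_scale// -mulrBr exprMn EFinM.
  over.
rewrite ge0_integralZl//; last 3 first.
- exact: measurable_mvn_sqr.
- by move=> s _; rewrite lee_fin sqr_ge0.
- by rewrite lee_fin sqr_ge0.
rewrite -[X in (_ * (_ * X))%E]fineK; last first.
  rewrite ge0_fin_numE; first exact: mvn_unit_fin.
  by apply: integral_ge0 => s _; rewrite lee_fin sqr_ge0.
rewrite -/mvn_const -!EFinM gtr0_norm//; congr EFin.
rewrite mulrA mulrC; congr (_ * _).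
rewrite -powR_mulrn ?powR_ge0// -powRrM -[X in X * _]powRr1 ?ltW//.
rewrite -powRD ?(gt_eqF r0) ?implybT//; congr (_ `^ _).
by field.
Qed.

Lemma sqr_powR_ge (c rho u : R) : `|c| <= 2^-1 -> 0 < rho ->
  rho / 2 <= u <= rho -> rho `^ (2 * c) / 2 <= (u `^ c) ^+ 2.
Proof.
rewrite ler_norml => /andP[c1 c2] r0 /andP[u1 u2].
have u0 : 0 < u by lra.
rewrite -powR_mulrn ?powR_ge0// -powRrM (mulrC c).
have [c0|c0] := leP 0 c.
  apply: (@le_trans _ _ ((rho / 2) `^ (2 * c))); last first.
    by apply: ge0_ler_powR; rewrite ?nnegrE//; lra.
  rewrite powRM ?ler_pM2l ?powR_gt0//; try lra.
  have : (2^-1 : R) `^ 1 <= 2^-1 `^ (2 * c).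
    by apply: ger_powR; lra.
  by rewrite powRr1.
apply: (@le_trans _ _ (rho `^ (2 * c))).
  by rewrite ler_pdivrMr// ler_peMr ?powR_ge0//; lra.
rewrite -[2 * c]opprK ![_ `^ (- - _)]powRN lef_pV2 ?posrE ?powR_gt0//.
by apply: ge0_ler_powR; rewrite ?nnegrE//; lra.
Qed.

(** Just to the right of [- x k] only the kernel of the latest time [x k] is
    alive, so no combination of the earlier ones can cancel it there. *)
Lemma mvn_sum_lower_bound (k : nat) (x a : nat -> R) (rho : R) :
  0 < rho -> (forall i, (i < k)%N -> x i <= x k - rho) -> a k = 1 ->
  ((rho `^ (2 * alpha) / 4)%:E <=
   \int[lebesgue_measure]_s
     ((\sum_(i < k.+1) a i * mvn alpha (s + x i)) ^+ 2)%:E)%E.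
Proof.
move=> rho0 xk ak; have /andP[a0 a1] := alpha01.
pose D : set R := `[- x k + rho / 2, - x k + rho]%classic.
have mf (E : set R) : measurable_fun E
    (fun s : R => ((\sum_(i < k.+1) a i * mvn alpha (s + x i)) ^+ 2)%:E).
  apply/measurable_funTS/measurable_EFinP/measurable_funX.
  apply: measurable_sum => i; apply: measurable_funM => //.
  exact: measurable_mvn.
apply: (@le_trans _ _ (\int[lebesgue_measure]_(s in D)
    ((\sum_(i < k.+1) a i * mvn alpha (s + x i)) ^+ 2)%:E)%E); last first.
  apply: ge0_subset_integral => //; [exact: measurable_itv|exact: mf|].
  by move=> s _; rewrite lee_fin sqr_ge0.
apply: (@le_trans _ _ (\int[lebesgue_measure]_(s in D)
    (rho `^ (2 * (alpha - 2^-1)) / 2)%:E)%E).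
  rewrite integral_cst//; last exact: measurable_itv.
  rewrite [X in (_ * X)%E]lebesgue_measure_itv/= lte_fin ifT; last by lra.
  rewrite -EFinD -EFinM lee_fin.
  rewrite (_ : 2 * alpha = 2 * (alpha - 2^-1) + 1); last by field.
  rewrite powRD ?(gt_eqF rho0) ?implybT// powRr1 ?(ltW rho0)//.
  by rewrite le_eqVlt; apply/orP; left; apply/eqP; field.
apply: ge0_le_integral => //.
- exact: measurable_itv.
- by move=> s _; rewrite lee_fin mulr_ge0 ?powR_ge0.
- exact: mf.
- move=> s; rewrite /D /= in_itv/= => /andP[s1 s2]; rewrite lee_fin.
  rewrite big_ord_recr/= ak mul1r big1 ?add0r; last first.
    move=> i _; rewrite /mvn ifN ?mulr0// -leNgt.
    by have := xk i (ltn_ord i); lra.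
  rewrite /mvn ifT; last by lra.
  by apply: sqr_powR_ge => //; rewrite ?ler_norml; lra.
Qed.

Lemma mvn_const_gt0 : 0 < mvn_const.
Proof.
have := @mvn_sum_lower_bound 1 (fun i => i%:R) (fun i => if i is 0 then -1 else 1) 1 ltr01.
have -> : (\int[lebesgue_measure]_s
    ((\sum_(i < 2) (match nat_of_ord i with 0%N => -1 | _ => 1 end) * mvn alpha (s + (i : nat)%:R)) ^+ 2)%:E
   = mvn_const%:E)%E.
  have := integral_mvn_increment 1 0.
  rewrite subr0 normr1 powR1 mulr1 => <-.
  apply: eq_integral => s _; congr EFin.
  by rewrite !big_ord_recr big_ord0 /= !mul1r add0r mulN1r addrC.
rewrite powR1 lee_fin => H.
apply: lt_le_trans (H _ _) => //.
by move=> [|//] _ /=; lra.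
Qed.

(** The right-hand side is the variance of a balanced combination of a fractional
    Brownian motion: given the past, its value at time [x k] keeps a variance of
    order [rho `^ (2 * alpha)]. *)
Lemma local_nondeterminism (k : nat) (x a : nat -> R) (rho : R) :
  0 < rho -> (forall i, (i < k)%N -> x i <= x k - rho) -> a k = 1 ->
  \sum_(i < k.+1) a i = 0 ->
  (4 * mvn_const)^-1 * rho `^ (2 * alpha) <=
   - 2^-1 * \sum_(i < k.+1) \sum_(j < k.+1)
     a i * a j * `|x i - x j| `^ (2 * alpha).
Proof.
move=> rho0 xk ak sa.
have := mvn_sum_lower_bound rho0 xk ak.
rewrite (@integral_sqr_sum _ (measurableTypeR R) _ _ _
  (fun (i : 'I_k.+1) (s : R) => mvn alpha (s + x i))
  (fun i j => mvn_const * `|x i - x j| `^ (2 * alpha)) (fun i : 'I_k.+1 => a i)) => //.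
- rewrite lee_fin => H.
  rewrite invfM mulrC mulrA mulrC ler_pdivrMl ?mvn_const_gt0//.
  apply: le_trans H _; rewrite mulrCA le_eqVlt; apply/orP; left; apply/eqP.
  congr (_ * _); rewrite mulr_sumr; apply: eq_bigr => i _.
  rewrite mulr_sumr; apply: eq_bigr => j _; ring.
- by move=> i; exact: measurable_mvn.
- by move=> i j; exact: integral_mvn_increment.
Qed.

End fractional_kernel.

(** * Functions with Gaussian decay *)

Section gaussian_integrals.
Context (R : realType).
Implicit Types (s x : R).
Notation mu := (@lebesgue_measure R).

(** This is [expR (- x ^+ 2 / 4)]: half of the Gaussian exponent, the other half
    being used to absorb polynomial factors. *)
Definition wide_gauss x : R := gauss_fun (2^-1 * x + 0).

Lemma measurable_wide_gauss : measurable_fun setT wide_gauss.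
Proof.
apply: (@measurableT_comp _ _ _ _ _ _ (@gauss_fun R)).
  exact: measurable_gauss_fun.
by apply: measurable_funD => //; exact: measurable_funM.
Qed.

Lemma integral_wide_gauss :
  (\int[mu]_x (wide_gauss x)%:E = (2 * Num.sqrt pi)%:E)%E.
Proof.
have h2 : (0 : R) < 2^-1 by rewrite invr_gt0.
have := @ge0_integral_affine R 2^-1 0 (fun x => (gauss_fun x)%:E) h2.
rewrite integralT_gauss => H.
rewrite EFinM [X in (_ * X)%E]H; last 2 first.
- by apply/measurable_EFinP; exact: measurable_gauss_fun.
- by move=> x; rewrite lee_fin gauss_fun_ge0.
by rewrite muleA -EFinM divff// mul1e.
Qed.

Lemma integrable_wide_gauss : mu.-integrable setT (EFin \o wide_gauss).
Proof.
apply/integrableP; split.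
  by apply/measurable_EFinP; exact: measurable_wide_gauss.
under eq_integral do rewrite /= ger0_norm ?gauss_fun_ge0//.
by rewrite integral_wide_gauss ltry.
Qed.

Lemma integrable_dominated (f : R -> R) (C : R) : measurable_fun setT f ->
  (forall x, `|f x| <= C * wide_gauss x) -> mu.-integrable setT (EFin \o f).
Proof.
move=> mf fC.
apply: (@le_integrable _ _ _ mu setT measurableT _ (fun x => (C%:E * (wide_gauss x)%:E)%E)) => //.
- exact/measurable_EFinP.
- move=> x _ /=; rewrite lee_fin.
  by apply: le_trans (fC x) _; exact: ler_norm.
- by apply: integrableZl => //; exact: integrable_wide_gauss.
Qed.

Lemma expR_wide_gauss x : expR (- (x ^+ 2 / 2)) = wide_gauss x ^+ 2.
Proof.
rewrite /wide_gauss /gauss_fun -expRM_natl; congr expR; by field.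
Qed.

Lemma wide_gauss_le x : (1 + x ^+ 2 / 4) * wide_gauss x <= 1.
Proof.
rewrite -[leRHS](@mulfV _ (expR (x ^+ 2 / 4))) ?gt_eqF ?expR_gt0//.
rewrite -expRN /wide_gauss /gauss_fun.
rewrite (_ : - (2^-1 * x + 0) ^+ 2 = - (x ^+ 2 / 4)); last by field.
by rewrite ler_pM2r ?expR_gt0// expR_ge1Dx.
Qed.

Lemma wide_gauss_ge0 x : 0 <= wide_gauss x.
Proof. exact: gauss_fun_ge0. Qed.

(** Plays the part of integration by parts on the whole line: the boundary terms
    at [- n.+1] and [n.+1] vanish in the limit. *)
Lemma integral_derivative_gauss (F f : R -> R) (C : R) :
  (forall x, is_derive x 1 F (f x)) -> continuous f ->
  (forall x, `|F x| <= C * wide_gauss x) ->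
  (forall x, `|f x| <= C * wide_gauss x) ->
  (\int[mu]_x (f x)%:E = 0)%E.
Proof.
move=> dF cf FC fC.
have C0 : 0 <= C.
  have := fC 0; have := wide_gauss_le 0.
  rewrite expr0n mul0r addr0 mul1r => _ H.
  have : 0 <= C * wide_gauss 0 by apply: le_trans H; exact: normr_ge0.
  by rewrite pmulr_lge0// expR_gt0.
have mf : measurable_fun setT f by exact: continuous_measurable_fun.
pose f_ (n : nat) := (EFin \o f) \_ (`[- n.+1%:R, n.+1%:R] : set R).
have mf_ n : measurable_fun setT (f_ n).
  apply/measurable_restrict => //; rewrite setTI.
  exact/measurable_funTS/measurable_EFinP.
have E n : (\int[mu]_x f_ n x = (F n.+1%:R - F (- n.+1%:R))%:E)%E.
  rewrite /f_ -integral_mkcond.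
  have cF (z : R) : {for z, continuous F}.
    by apply: differentiable_continuous; apply/derivable1_diffP; case: (dF z).
  rewrite (@continuous_FTC2 _ f F)//.
  - by rewrite (@lt_trans _ _ 0)// oppr_lt0.
  - by apply: continuous_subspaceT.
  - split.
    + by move=> z _; case: (dF z).
    + by apply: cvg_at_right_filter; apply: cF.
    + by apply: cvg_at_left_filter; apply: cF.
  - by move=> z _; rewrite derive1E; have [_ ->] := dF z.
have [||||_ _] := @dominated_convergence _ _ _ mu setT measurableT f_ (EFin \o f)
  (fun x => (C%:E * (wide_gauss x)%:E)%E) mf_.
- exact/measurable_EFinP.
- apply: aeW => x _; apply: cvg_near_cst.
  exists (Num.truncn `|x|) => // n /= xn; rewrite /f_ patchE mem_setE in_itv/=.
  rewrite -ler_norml ifT//; apply: ltW.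
  by apply: lt_le_trans (truncnS_gt _) _; rewrite ler_nat.
- by apply: integrableZl => //; exact: integrable_wide_gauss.
- apply: aeW => x n _; rewrite /f_ patchE; case: ifP => _ /=; rewrite lee_fin//.
  by rewrite normr0 mulr_ge0// wide_gauss_ge0.
under eq_fun do rewrite E.
move=> cv; rewrite -(cvg_lim _ cv)//; apply/cvg_lim => //.
apply: cvg_EFin; first exact: nearW.
have W n : wide_gauss n.+1%:R <= 4 * n.+1%:R^-1.
  have w := wide_gauss_le n.+1%:R; have w0 := wide_gauss_ge0 n.+1%:R.
  have n1 : (1 : R) <= n.+1%:R by rewrite ler1n.
  rewrite -[4 * _]/(4 / _) ler_pdivlMr; nra.
have NW n : wide_gauss (- n.+1%:R) = wide_gauss n.+1%:R.
  by rewrite /wide_gauss /gauss_fun; congr expR; ring.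
apply: norm_cvg0.
apply: (@squeeze_cvgr _ _ _ _ (cst 0) (fun n => (8 * C) * harmonic n)).
- apply: nearW => n /=; rewrite normr_ge0 /=.
  apply: le_trans (ler_normB _ _) _.
  have h1 := FC n.+1%:R; have h2 := FC (- n.+1%:R); rewrite NW in h2.
  apply: le_trans (lerD h1 h2) _.
  have := ler_wpM2l C0 (W n); rewrite /harmonic /=.
  by move: (n.+1%:R^-1) (wide_gauss _) => u v; nra.
- exact: cvg_cst.
- rewrite -[X in _ --> X](mulr0 (8 * C)); apply: cvgM; first exact: cvg_cst.
  exact: cvg_harmonic.
Qed.

Lemma normal_pdf01E x : normal_pdf 0 1 x =
  normal_peak (1 : R) * wide_gauss x ^+ 2.
Proof.
rewrite normal_pdfE ?oner_neq0// /normal_fun -expR_wide_gauss; congr (_ * expR _).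
by field.
Qed.

End gaussian_integrals.

(** * The standard normal law *)

Section standard_normal.
Context (R : realType).
Implicit Types (s x t : R).
Notation mu := (@lebesgue_measure R).
Notation N01 := (@normal_prob R 0 1).

Lemma ge0_integral_normal (f : R -> \bar R) :
  (forall x, (0 <= f x)%E) -> measurable_fun setT f ->
  (\int[N01]_x f x = \int[mu]_x (f x * (normal_pdf 0 1 x)%:E))%E.
Proof.
move=> f0 mf.
have dom := @normal_prob_dominates R 0 1.
rewrite -(Radon_Nikodym_SigmaFinite.change_of_variables dom)//.
have mr : measurable_fun setT (Radon_Nikodym_SigmaFinite.f N01 mu).
  exact: measurable_int (Radon_Nikodym_SigmaFinite.f_integrable dom).
have mp : measurable_fun setT (fun x : R => (normal_pdf 0 1 x)%:E).
  by apply/measurable_EFinP; exact: measurable_normal_pdf.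
apply: ae_eq_integral => //; [exact: emeasurable_funM|exact: emeasurable_funM|].
apply: ae_eqe_mul2l; apply: integral_ae_eq => //.
  exact: Radon_Nikodym_SigmaFinite.f_integrable.
by move=> E _ mE; rewrite -Radon_Nikodym_SigmaFinite.f_integral.
Qed.

Lemma integral_normal (f : R -> R) :
  measurable_fun setT f ->
  mu.-integrable setT (EFin \o (f \* normal_pdf 0 1)) ->
  (\int[N01]_x (f x)%:E = \int[mu]_x (f x * normal_pdf 0 1 x)%:E)%E.
Proof.
move=> mf fi.
rewrite integralE [RHS]integralE; congr (_ - _)%E.
- rewrite ge0_integral_normal//.
    apply: eq_integral => x _; rewrite !funeposE -EFin_max -EFinM -EFin_max.
    rewrite maxr_pMl ?normal_pdf_ge0// mul0r. by [].
  by apply/measurable_funepos/measurable_EFinP.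
- rewrite ge0_integral_normal//.
    apply: eq_integral => x _; rewrite !funenegE -!EFinN -!EFin_max -EFinM.
    by rewrite maxr_pMl ?normal_pdf_ge0// mul0r mulNr.
  by apply/measurable_funeneg/measurable_EFinP.
Qed.

Lemma is_derive_normal_pdf x :
  is_derive x 1 (normal_pdf 0 1 : R -> R) (- x * normal_pdf 0 1 x).
Proof.
rewrite [X in is_derive _ _ X](_ : _ =
  (fun x => normal_peak (1 : R) * expR (- (x ^+ 2 / 2)))); last first.
  by apply/funext => y; rewrite normal_pdf01E expR_wide_gauss.
apply: is_derive_eq.
by rewrite /GRing.scale /= normal_pdf01E -expR_wide_gauss; field.
Qed.

Lemma continuous_normal_pdf01 : continuous (normal_pdf 0 1 : R -> R).
Proof. exact: continuous_normal_pdf (oner_neq0 R). Qed.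

Lemma normal_pdf01_le x :
  (1 + x ^+ 2 / 4) * normal_pdf 0 1 x <= normal_peak (1 : R) * wide_gauss x.
Proof.
rewrite normal_pdf01E; have := wide_gauss_le x; have := wide_gauss_ge0 x.
have := normal_peak_ge0 (1 : R).
move: (wide_gauss x) (normal_peak 1) => w p p0 w0 H.
rewrite [leLHS](_ : _ = p * w * ((1 + x ^+ 2 / 4) * w)); last by ring.
by rewrite ler_piMr// mulr_ge0.
Qed.

(** Quadratic growth is absorbed by half of the Gaussian exponent; this one bound
    justifies every integrability claim on the standard normal law. *)
Lemma normal_pdf01_poly_le (f : R -> R) (C : R) x :
  `|f x| <= C * (1 + x ^+ 2 / 4) ->
  `|f x * normal_pdf 0 1 x| <= (C * normal_peak (1 : R)) * wide_gauss x.
Proof.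
move=> fC; rewrite normrM [X in _ * X]ger0_norm ?normal_pdf_ge0//.
have C0 : 0 <= C.
  have : 0 <= C * (1 + x ^+ 2 / 4) by apply: le_trans fC.
  by rewrite pmulr_lge0//; nra.
apply: le_trans (ler_wpM2r (normal_pdf_ge0 _ _ _) fC) _.
by rewrite -2!(mulrA C) ler_wpM2l//; exact: normal_pdf01_le.
Qed.

Lemma integrable_poly_normal_pdf (f : R -> R) (C : R) :
  measurable_fun setT f ->
  (forall x, `|f x| <= C * (1 + x ^+ 2 / 4)) ->
  mu.-integrable setT (EFin \o (f \* normal_pdf 0 1)).
Proof.
move=> mf fC; apply: (@integrable_dominated _ _ (C * normal_peak 1)).
  by apply: measurable_funM => //; exact: measurable_normal_pdf.
by move=> x; exact: normal_pdf01_poly_le.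
Qed.

Lemma normal_mean0 : (\int[N01]_x x%:E = 0)%E.
Proof.
have X x : `|x| <= 1 + x ^+ 2 / 4.
  have := sqr_ge0 (1 - x / 2); have := sqr_ge0 (1 + x / 2).
  by rewrite ler_norml => ? ?; apply/andP; split; nra.
rewrite (@integral_normal id)//; last first.
  by apply: (@integrable_poly_normal_pdf id 1) => // x; rewrite mul1r.
have := @integral_derivative_gauss R (fun x => - normal_pdf 0 1 x)
  (fun x => x * normal_pdf 0 1 x) (1 * normal_peak 1); apply.
- move=> x; have h := is_derive_normal_pdf x.
  by apply: is_derive_eq; rewrite mulNr opprK.
- by move=> x; apply: cvgM => //; exact: continuous_normal_pdf01.
- move=> x; rewrite normrN -[normal_pdf 0 1 x]mul1r.
  apply: (@normal_pdf01_poly_le (cst 1)); rewrite /= normr1; nra.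
- by move=> x; apply: (@normal_pdf01_poly_le id); rewrite mul1r.
Qed.

Lemma normal_var1 : (\int[N01]_x (x ^+ 2)%:E = 1)%E.
Proof.
have X x : `|x ^+ 2| <= 4 * (1 + x ^+ 2 / 4).
  by rewrite ger0_norm ?sqr_ge0//; nra.
have Y x : `|1 - x ^+ 2| <= 4 * (1 + x ^+ 2 / 4).
  by rewrite ler_norml; apply/andP; split; nra.
have m2 : measurable_fun setT (fun x : R => x ^+ 2).
  exact: (measurable_funX 2 (@measurable_id _ _ setT)).
have i2 : mu.-integrable setT (EFin \o ((fun x => x ^+ 2) \* normal_pdf 0 1)).
  by apply: (@integrable_poly_normal_pdf _ 4).
rewrite integral_normal//.
have : (\int[mu]_x ((1 - x ^+ 2) * normal_pdf 0 1 x)%:E = 0)%E.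
  have := @integral_derivative_gauss R (fun x => x * normal_pdf 0 1 x)
    (fun x => (1 - x ^+ 2) * normal_pdf 0 1 x) (4 * normal_peak 1); apply.
  - move=> x; have h := is_derive_normal_pdf x.
    by apply: is_derive_eq; rewrite /GRing.scale /=; ring.
  - move=> x; apply: cvgM; last exact: continuous_normal_pdf01.
    by apply: cvgB; [exact: cvg_cst|exact: exprn_continuous].
  - move=> x; apply: (@normal_pdf01_poly_le id).
    have := sqr_ge0 (1 - x / 2); have := sqr_ge0 (1 + x / 2).
    by rewrite ler_norml => ? ?; apply/andP; split; nra.
  - by move=> x; apply: (@normal_pdf01_poly_le (fun x => 1 - x ^+ 2)).
under eq_integral do rewrite mulrBl mul1r EFinB.
rewrite integralB//; last exact: integrable_normal_pdf.
rewrite integral_normal_pdf.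
have := integrable_fin_num measurableT i2; rewrite /=.
case: (\int[mu]_x _)%E => // r _; rewrite -EFinB => -[] H; congr EFin; lra.
Qed.

Lemma cos_normal_le1 s x : `|cos (s * x)| <= 1 * (1 + x ^+ 2 / 4).
Proof. by have := cos_max (s * x); nra. Qed.

Lemma measurable_cos_mul s : measurable_fun setT (fun x : R => cos (s * x)).
Proof.
apply: continuous_measurable_fun => x.
by apply: (continuous_comp (f := fun x => s * x)); [exact: mulrl_continuous|exact: continuous_cos].
Qed.

Let phi s := (\int[mu]_x (cos (s * x) * normal_pdf 0 1 x))%R.

(** Differentiate under the integral, then integrate [x * normal_pdf 0 1 x] by
    parts. *)
Lemma is_derive_phi s : is_derive s 1 phi (- s * phi s).
Proof.
pose f s x : R := cos (s * x) * normal_pdf 0 1 x.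
have df x t : is_derive t 1 (f ^~ x) (- x * sin (t * x) * normal_pdf 0 1 x).
  by apply: is_derive_eq; rewrite /GRing.scale /=; ring.
have d1 t x : partial1of2 f t x = - x * sin (t * x) * normal_pdf 0 1 x.
  by rewrite partial1of2E; have [_ ->] := df x t.
have X x : `|x| <= 1 + x ^+ 2 / 4.
  have := sqr_ge0 (1 - x / 2); have := sqr_ge0 (1 + x / 2).
  by rewrite ler_norml => ? ?; apply/andP; split; nra.
have XS t x : `|- x * sin (t * x)| <= 1 * (1 + x ^+ 2 / 4).
  rewrite mul1r normrM normrN; apply: le_trans (X x).
  by rewrite ler_piMr//; exact: sin_max.
have ms t : measurable_fun setT (fun x : R => - x * sin (t * x)).
  apply: measurable_funM; first exact: measurable_funN.
  apply: continuous_measurable_fun => x.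
  by apply: (continuous_comp (f := fun x => t * x)); [exact: mulrl_continuous|exact: continuous_sin].
have i1 t : mu.-integrable setT (EFin \o f t).
  apply: (@integrable_poly_normal_pdf (fun x => cos (t * x)) 1).
    exact: measurable_cos_mul.
  by move=> x; exact: cos_normal_le1.
have i2 t : mu.-integrable setT (EFin \o (fun x => - x * sin (t * x) * normal_pdf 0 1 x)).
  exact: (@integrable_poly_normal_pdf (fun x => - x * sin (t * x)) 1).
have sI : (`]s - 1, s + 1[%classic : set R) s.
  by rewrite /= in_itv/=; apply/andP; split; lra.
have A1 : forall x, (`]s - 1, s + 1[%classic : set R) x -> mu.-integrable setT (EFin \o f x) by move=> x _.
have A2 : forall x y, (`]s - 1, s + 1[%classic : set R) x -> [set: R] y -> derivable (f ^~ y) x 1.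
  by move=> x y _ _; case: (df y x).
pose G x := 1 * normal_peak 1 * wide_gauss x.
have A3 x : 0 <= G x.
  by rewrite /G mul1r mulr_ge0 ?normal_peak_ge0 ?wide_gauss_ge0.
have A4 : mu.-integrable setT (EFin \o G).
  rewrite /G; apply: (@integrable_dominated _ _ (1 * normal_peak 1)).
    by apply: measurable_funM => //; exact: measurable_wide_gauss.
  by move=> x; rewrite ger0_norm//; exact: A3.
have A5 : forall x y, (`]s - 1, s + 1[%classic : set R) x -> [set: R] y -> `|partial1of2 f x y| <= G y.
  by move=> x y _ _; rewrite d1; apply: (@normal_pdf01_poly_le (fun y => - y * sin (x * y))).
have dphi := @derivable_under_integral R _ _ mu f setT measurableT s _ _ sI A1 A2 G A3 A4 A5.
have := @differentiation_under_integral R _ _ mu f setT measurableT s _ _ sI A1 A2 G A3 A4 A5.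
rewrite derive1E -/(phi) => E; apply: DeriveDef => //.
rewrite [LHS]E; under eq_Rintegral do rewrite d1.
have : (\int[mu]_x (s * (cos (s * x) * normal_pdf 0 1 x) + (- x * sin (s * x) * normal_pdf 0 1 x))%:E = 0)%E.
  have := @integral_derivative_gauss R (fun x => sin (s * x) * normal_pdf 0 1 x)
    (fun x => s * (cos (s * x) * normal_pdf 0 1 x) + (- x * sin (s * x) * normal_pdf 0 1 x))
    ((`|s| + 1) * normal_peak 1); apply.
  - move=> x; have h := is_derive_normal_pdf x.
    by apply: is_derive_eq; rewrite /GRing.scale /=; ring.
  - move=> x; apply: cvgD; apply: cvgM; try exact: cvg_cst; try exact: continuous_normal_pdf01.
    + apply: cvgM; last exact: continuous_normal_pdf01.
      by apply: (continuous_comp (f := fun x => s * x)); [exact: mulrl_continuous|exact: continuous_cos].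
    + apply: cvgM; first exact: (@cvgN _ R^o).
      by apply: (continuous_comp (f := fun x => s * x)); [exact: mulrl_continuous|exact: continuous_sin].
  - move=> x; apply: (@normal_pdf01_poly_le (fun x => sin (s * x))).
    by have := sin_max (s * x); have := normr_ge0 s; nra.
  - move=> x; rewrite mulrA -mulrDl.
    apply: (@normal_pdf01_poly_le (fun x => s * cos (s * x) + - x * sin (s * x))).
    apply: le_trans (ler_normD _ _) _; rewrite mulrDl lerD//.
    by rewrite normrM ler_wpM2l//; move: (cos_normal_le1 s x); rewrite mul1r.
under eq_integral do rewrite EFinD EFinM.
have i1s : mu.-integrable setT (fun x => (s%:E * (f s x)%:E)%E).
  by apply: (@integrableZl _ _ _ mu setT measurableT s (EFin \o f s)).
rewrite integralD//; last exact: i2.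
rewrite [X in (X + _)%E](_ : _ = s%:E * \int[mu]_x (f s x)%:E)%E; last first.
  exact: (@integralZl _ _ _ mu setT measurableT (EFin \o f s) (i1 s) s).
rewrite /phi /Rintegral -[X in (_ * X)%E]fineK; last exact: (integrable_fin_num measurableT (i1 s)).
rewrite -[X in (_ + X)%E]fineK; last exact: (integrable_fin_num measurableT (i2 s)).
rewrite -EFinM -EFinD => -[] H; apply/eqP; rewrite -subr_eq0 mulNr opprK addrC; apply/eqP.
exact: H.
Qed.

(** Both sides solve [y' = - s * y] and agree at [0]. *)
Lemma normal_cos s : (\int[N01]_x (cos (s * x))%:E = (expR (- (s ^+ 2 / 2)))%:E)%E.
Proof.
have i1 t : mu.-integrable setT (EFin \o ((fun x => cos (t * x)) \* normal_pdf 0 1)).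
  apply: (@integrable_poly_normal_pdf _ 1).
    exact: measurable_cos_mul.
  by move=> x; exact: cos_normal_le1.
rewrite integral_normal//; last exact: measurable_cos_mul.
rewrite -[LHS]fineK; last exact: (integrable_fin_num measurableT (i1 s)).
congr EFin; rewrite -/(phi s).
have D t : is_derive t 1 (fun t => phi t * expR (t ^+ 2 / 2)) 0.
  have h := is_derive_phi t.
  by apply: is_derive_eq; rewrite /GRing.scale /=; field.
have := is_derive_0_is_cst s 0 D.
rewrite expr0n mul0r expR0 mulr1.
have -> : phi 0 = 1.
  rewrite /phi /Rintegral; under eq_integral do rewrite mul0r cos0 mul1r.
  by rewrite integral_normal_pdf.
by move=> H; rewrite expRN -[LHS](@mulfK _ (expR (s ^+ 2 / 2))) ?gt_eqF ?expR_gt0// H mul1r.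
Qed.

Lemma normal_tail t : 0 <= t ->
  (N01 [set x | (t < `|x|)%R] <= (2 * expR (- (t ^+ 2 / 4)))%:E)%E.
Proof.
move=> t0.
have mD : measurable [set x : R | t < `|x|].
  rewrite -[X in measurable X]setTI.
  exact: (@measurable_fun_ltr _ _ _ _ (cst t) (fun x => `|x|)).
rewrite /normal_prob; set D := [set x | _] in mD *.
apply: (@le_trans _ _ (\int[mu]_(x in D)
   ((expR (- (t ^+ 2 / 4)) * normal_peak 1)%:E * (wide_gauss x)%:E)%E)%E).
  apply: ge0_le_integral => //.
  - by move=> x _; rewrite lee_fin normal_pdf_ge0.
  - by apply/measurable_funTS/measurable_EFinP; exact: measurable_normal_pdf.
  - apply/measurable_funeM/measurable_funTS/measurable_EFinP; exact: measurable_wide_gauss.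
  - move=> x /= tx; rewrite -EFinM lee_fin normal_pdf01E expr2 mulrA.
    rewrite ler_wpM2r ?wide_gauss_ge0// mulrC ler_wpM2r ?normal_peak_ge0//.
    rewrite /wide_gauss /gauss_fun ler_expR lerN2.
    rewrite (_ : (2^-1 * x + 0) ^+ 2 = `|x| ^+ 2 / 4); last first.
      by rewrite real_normK ?num_real//; field.
    by rewrite ler_pM2r ?invr_gt0// ler_sqr ?nnegrE// ltW.
apply: (@le_trans _ _ (\int[mu]_x
   ((expR (- (t ^+ 2 / 4)) * normal_peak 1)%:E * (wide_gauss x)%:E)%E)%E).
  apply: ge0_subset_integral => //.
  - by apply: measurable_funeM; apply/measurable_EFinP; exact: measurable_wide_gauss.
  - by move=> x _; rewrite -EFinM lee_fin !mulr_ge0 ?expR_ge0 ?normal_peak_ge0 ?wide_gauss_ge0.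
rewrite ge0_integralZl//; last 3 first.
- by apply/measurable_EFinP; exact: measurable_wide_gauss.
- by move=> x _; rewrite lee_fin wide_gauss_ge0.
- by rewrite lee_fin mulr_ge0 ?expR_ge0 ?normal_peak_ge0.
rewrite integral_wide_gauss -EFinM lee_fin.
have : normal_peak 1 * Num.sqrt pi <= (1 : R).
  have sp : 0 < Num.sqrt (1 ^+ 2 * pi *+ 2 : R).
    by rewrite sqrtr_gt0 expr1n mul1r mulrn_wgt0// pi_gt0.
  rewrite /normal_peak mulrC ler_pdivrMr// mul1r expr1n mul1r.
  by apply: ler_wsqrtr; rewrite mulr2n lerDl pi_ge0.
have := expR_ge0 (- (t ^+ 2 / 4)).
by move: (expR _) (normal_peak _) (Num.sqrt _) => e p q; nra.
Qed.

End standard_normal.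

(** * Gaussian laws *)

Section laws.
Context (d : measure_display) (T : measurableType d) (R : realType)
  (P : probability T R).
Notation N01 := (@normal_prob R 0 1).
Notation mu := (@lebesgue_measure R).

Lemma normal_pdf_standardize (m s x : R) : 0 < s ->
  s * normal_pdf m s (s * x + m) = normal_pdf 0 1 x.
Proof.
move=> s0; rewrite !normal_pdfE ?oner_neq0 ?gt_eqF// mulrA /normal_peak /normal_fun.
congr (_ * _).
  rewrite expr1n mul1r -mulrnAr sqrtrM ?sqr_ge0// sqrtr_sqr gtr0_norm//.
  by rewrite invfM mulrA divff ?mul1r// gt_eqF.
by congr expR; field; rewrite gt_eqF.
Qed.

Lemma normal_prob_standardize (m s : R) (V : set R) : 0 < s -> measurable V ->
  normal_prob m s V = N01 ((fun x => s * x + m) @^-1` V).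
Proof.
move=> s0 mV; rewrite /normal_prob integral_mkcond [RHS]integral_mkcond.
rewrite (@ge0_integral_affine _ s m)//; last 2 first.
- apply/(measurable_restrictT _ _).1 => //.
  by apply/measurable_funTS/measurable_EFinP; exact: measurable_normal_pdf.
- by move=> x; apply: erestrict_ge0 => y _; rewrite lee_fin normal_pdf_ge0.
rewrite -ge0_integralZl//; last 3 first.
- apply: (@measurableT_comp _ _ _ _ _ _ ((fun x => (normal_pdf m s x)%:E) \_ V)).
    apply/(measurable_restrictT _ _).1 => //.
    by apply/measurable_funTS/measurable_EFinP; exact: measurable_normal_pdf.
  by apply: measurable_funD => //; exact: measurable_funM.
- by move=> x _; apply: erestrict_ge0 => y _; rewrite lee_fin normal_pdf_ge0.
- by rewrite lee_fin ltW.
apply: eq_integral => x _; rewrite !patchE.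
have -> : (x \in (fun x => s * x + m) @^-1` V) = (s * x + m \in V).
  by apply/idP/idP; rewrite !inE.
case: ifP => _; last by rewrite mule0.
by rewrite -EFinM normal_pdf_standardize.
Qed.

(** With [s = 0] allowed, point masses are covered too, and no later argument
    has to treat them separately. *)
Lemma gaussian_law_affine (Y : T -> R) :
  gaussian_law (pushforward P Y) -> exists m s : R, 0 <= s /\
    forall V, measurable V -> P (Y @^-1` V) = N01 ((fun x => s * x + m) @^-1` V).
Proof.
move=> [m [s [[s0 H]|[s0 H]]]]; exists m.
  exists 0; split => // V mV; rewrite [LHS](H V mV) diracE.
  have [mV'|mV'] := boolP (m \in V).
    rewrite (_ : _ @^-1` V = setT) ?probability_setT//.
    by apply/seteqP; split => // x _ /=; rewrite mul0r add0r; exact/set_mem.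
  rewrite (_ : _ @^-1` V = set0) ?measure0//.
  apply/seteqP; split => // x /=; rewrite mul0r add0r => /mem_set.
  by rewrite (negbTE mV').
exists s; split; first exact: ltW.
by move=> V mV; rewrite [LHS](H V mV) normal_prob_standardize.
Qed.

Section transfer.
Variables (Y : T -> R) (g : R -> R).
Hypotheses (mY : measurable_fun setT Y) (mg : measurable_fun setT g).
Hypothesis Yg : forall V, measurable V -> P (Y @^-1` V) = N01 (g @^-1` V).

Lemma ge0_integral_law (f : R -> \bar R) : measurable_fun setT f ->
  (forall x, (0 <= f x)%E) -> (\int[P]_w f (Y w) = \int[N01]_x f (g x))%E.
Proof.
move=> mf f0.
have := @ge0_integral_pushforward _ _ _ _ _ _ mY P setT f measurableT mf (fun x _ => f0 x).
rewrite preimage_setT => <-.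
have := @ge0_integral_pushforward _ _ (measurableTypeR R) _ _ g mg N01 setT f measurableT mf (fun x _ => f0 x).
rewrite preimage_setT => <-.
by apply: eq_measure_integral => A mA _; exact: Yg.
Qed.

Lemma integrable_law (f : R -> R) : measurable_fun setT f ->
  N01.-integrable setT (EFin \o (f \o g)) -> P.-integrable setT (EFin \o (f \o Y)).
Proof.
move=> mf /integrableP[_ fin]; apply/integrableP; split.
  by apply/measurable_EFinP; exact: measurableT_comp.
rewrite (@ge0_integral_law (fun x => `|(f x)%:E|%E))//.
by apply: measurableT_comp => //; exact/measurable_EFinP.
Qed.

Lemma integral_law (f : R -> R) : measurable_fun setT f ->
  N01.-integrable setT (EFin \o (f \o g)) ->
  (\int[P]_w (f (Y w))%:E = \int[N01]_x (f (g x))%:E)%E.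
Proof.
move=> mf intf.
have mEf : measurable_fun setT (EFin \o f) by exact/measurable_EFinP.
have := @integral_pushforward _ _ _ _ _ _ mY P setT (EFin \o f) mEf.
rewrite preimage_setT /= => <- //; last exact: integrable_law.
have := @integral_pushforward _ _ (measurableTypeR R) _ _ g mg N01 setT (EFin \o f) mEf.
rewrite preimage_setT /= => <- //.
by apply: eq_measure_integral => A mA _; exact: Yg.
Qed.

End transfer.

Lemma integrable_normal_sqr : N01.-integrable setT (fun x : R => (x ^+ 2)%:E).
Proof.
apply/integrableP; split.
  by apply/measurable_EFinP; exact: (measurable_funX 2 (@measurable_id _ _ setT)).
under eq_integral do rewrite gee0_abs ?lee_fin ?sqr_ge0//.
by rewrite normal_var1 ltry.
Qed.

Lemma integrable_normal_bounded (f : R -> R) (C : R) : measurable_fun setT f ->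
  (forall x, `|f x| <= C) -> N01.-integrable setT (EFin \o f).
Proof.
move=> mf fC; apply: (@le_integrable _ (measurableTypeR R) _ N01 setT measurableT _ (cst C%:E)) => //.
- exact/measurable_EFinP.
- by move=> x _ /=; rewrite lee_fin (le_trans (fC x))// ler_norm.
- exact: finite_measure_integrable_cst.
Qed.

Lemma integrable_normal_id : N01.-integrable setT (fun x : R => x%:E).
Proof.
apply: (@le_integrable _ (measurableTypeR R) _ N01 setT measurableT _ (fun x : R => (1%:E + (x ^+ 2)%:E)%E)) => //.
- by apply/measurable_EFinP.
- move=> x _ /=; rewrite lee_fin [leRHS]ger0_norm; last by rewrite addr_ge0// sqr_ge0.
  have := sqr_ge0 (x + 2^-1); have := sqr_ge0 (x - 2^-1).
  by rewrite ler_norml => ? ?; apply/andP; split; nra.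
- apply: (@integrableD _ (measurableTypeR R) _ N01 setT measurableT (cst 1%:E)) => //.
    exact: finite_measure_integrable_cst.
  exact: integrable_normal_sqr.
Qed.

(** The first two moments identify the affine image of the standard law that [Y]
    follows. *)
Lemma gaussian_cos (Y : T -> R) (v : R) : measurable_fun setT Y ->
  gaussian_law (pushforward P Y) ->
  (\int[P]_w (Y w)%:E = 0)%E -> (\int[P]_w (Y w ^+ 2)%:E = v%:E)%E ->
  (\int[P]_w (cos (Y w))%:E = (expR (- (v / 2)))%:E)%E.
Proof.
move=> mY /gaussian_law_affine[m [s [s0 H]]] E1 E2.
have mg : measurable_fun setT (fun x : R => s * x + m).
  by apply: measurable_funD => //; exact: measurable_funM.
have I1 : N01.-integrable setT (fun x : R => (s%:E * x%:E)%E).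
  by apply: (@integrableZl _ (measurableTypeR R) _ N01 setT measurableT s EFin); exact: integrable_normal_id.
have I0 : N01.-integrable setT (fun x : R => m%:E).
  exact: finite_measure_integrable_cst.
have m0 : m = 0.
  move: E1; rewrite (@integral_law Y (fun x => s * x + m) mY mg H id)//; last first.
    exact: (@integrableD _ (measurableTypeR R) _ N01 setT measurableT _ _ I1 I0).
  under eq_integral do rewrite EFinD EFinM.
  rewrite integralD// integralZl//; last exact: integrable_normal_id.
  rewrite normal_mean0 mule0 add0e integral_cst//.
  rewrite [X in (_ * X)%E](_ : _ = 1%E); last exact: integral_normal_pdf.
  rewrite mule1.
  by case.
have v0 : v = s ^+ 2.
  move: E2; rewrite (@ge0_integral_law Y (fun x => s * x + m) mY mg H (fun x => (x ^+ 2)%:E)); last 2 first.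
  - by apply/measurable_EFinP; exact: (measurable_funX 2 (@measurable_id _ _ setT)).
  - by move=> x; rewrite lee_fin sqr_ge0.
  rewrite m0; under eq_integral do rewrite addr0 exprMn EFinM.
  rewrite integralZl//; last exact: integrable_normal_sqr.
  by rewrite normal_var1 mule1 => -[].
rewrite (@integral_law Y (fun x => s * x + m) mY mg H (@cos R)).
- by rewrite m0 v0 -normal_cos; under eq_integral do rewrite addr0.
- by apply: continuous_measurable_fun; exact: continuous_cos.
- apply: (@integrable_normal_bounded _ 1).
    apply: measurableT_comp => //.
    by apply: continuous_measurable_fun; exact: continuous_cos.
  by move=> x; exact: cos_max.
Qed.

End laws.

(** * Increments of fractional Brownian motion *)

Section fbm_increments.
Context (d : measure_display) (T : measurableType d) (R : realType)
  (P : probability T R) (alpha : R) (B : R -> {RV P >-> R}).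
Hypotheses (alpha01 : 0 < alpha < 1)
  (fbmB : fractional_brownian_motion `[0, 1] alpha B).
Notation N01 := (@normal_prob R 0 1).

Lemma ae_eq_preimage (X Y : T -> R) (V : set R) :
  measurable_fun setT X -> measurable_fun setT Y -> measurable V ->
  {ae P, forall w, X w = Y w} -> P (X @^-1` V) = P (Y @^-1` V).
Proof.
move=> mX mY mV XY.
have mXV : measurable (X @^-1` V) by rewrite -[X in measurable X]setTI; exact: mX.
have mYV : measurable (Y @^-1` V) by rewrite -[X in measurable X]setTI; exact: mY.
have E A : measurable A -> P A = (\int[P]_w (\1_A w)%:E)%E.
  by move=> mA; rewrite integral_indic// setIT.
rewrite !E//.
apply: ae_eq_integral => //.
- exact/measurable_EFinP/measurable_indic.
- exact/measurable_EFinP/measurable_indic.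
apply: filterS XY => w XYw _; congr EFin; rewrite !indicE /=; congr (_%:R).
by congr nat_of_bool; apply/idP/idP; rewrite !inE /= XYw.
Qed.

(** By stationarity the increment is distributed as [B (t - s) - B 0], and [B 0]
    vanishes almost surely. *)
Lemma fbm_increment_law (s t : R) (V : set R) :
  0 <= s -> s < t -> t <= 1 -> measurable V ->
  P ((fun w => B t w - B s w) @^-1` V) =
  N01 ((fun x => (t - s) `^ alpha * x) @^-1` V).
Proof.
case: fbmB => _ stat B0 nrm _ s0 st t1 mV.
have r0 : 0 < t - s by lra.
have I (x : R) : 0 <= x -> x <= 1 -> (`[0, 1]%classic : set R) x.
  by move=> ? ?; rewrite /= in_itv/=; apply/andP.
have := stat 0 (t - s) s.
rewrite subrK add0r => /(_ (I _ _ _) (I _ _ _) (I _ _ _) (I _ _ _)) H.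
rewrite [LHS](H ltac:(lra) ltac:(lra) ltac:(lra) ltac:(lra) ltac:(lra) ltac:(lra) ltac:(lra) ltac:(lra) V mV).
rewrite /pushforward (@ae_eq_preimage _ (B (t - s)))//.
- pose W := (fun x : R => (t - s) `^ alpha * x) @^-1` V.
  have mW : measurable W.
    by rewrite -[X in measurable X]setTI; exact: (@measurable_funM _ _ _ setT (cst _) id).
  have := nrm (t - s) (I (t - s) ltac:(lra) ltac:(lra)) r0 W mW; rewrite -/W => <-.
  rewrite /pushforward; congr (P _); apply/seteqP; split => w /=;
  by rewrite /W /= mulrA -powRD ?(gt_eqF r0) ?implybT// subrr powRr0 mul1r.
- exact: measurable_funB.
- by apply: filterS B0 => w ->; rewrite subr0.
Qed.

Lemma fbm_increment_tail (s t lambda : R) :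
  0 <= s -> s < t -> t <= 1 -> 0 <= lambda ->
  (P [set w | (lambda * (t - s) `^ alpha < `|B t w - B s w|)%R] <=
   (2 * expR (- (lambda ^+ 2 / 4)))%:E)%E.
Proof.
move=> s0 st t1 l0.
have r0 : 0 < (t - s) `^ alpha by rewrite powR_gt0; lra.
have mV : measurable [set x : R | lambda * (t - s) `^ alpha < `|x|].
  have mf : measurable_fun setT (fun x : R => lambda * (t - s) `^ alpha < `|x|).
    by apply: measurable_fun_ltr.
  by rewrite -[X in measurable X]setTI; exact: (mf measurableT [set true]).
have := fbm_increment_law s0 st t1 mV; rewrite /preimage /= => ->.
apply: le_trans (normal_tail l0); rewrite le_eqVlt; apply/orP; left; apply/eqP.
congr (normal_prob _ _ _); apply/seteqP; split => x /=;
  by rewrite normrM gtr0_norm// mulrC ltr_pM2l.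
Qed.

Lemma fbm_increment_variance (s t : R) : 0 <= s <= 1 -> 0 <= t <= 1 ->
  (\int[P]_w ((B s w - B t w) ^+ 2)%:E = (`|s - t| `^ (2 * alpha))%:E)%E.
Proof.
have /andP[a0 a1] := alpha01.
wlog st : s t / t <= s => [H|] s01 t01.
  have [st|st] := leP t s; first exact: H.
  rewrite distrC -H//; last exact: ltW.
  by apply: eq_integral => w _; congr EFin; ring.
rewrite le_eqVlt in st; case/orP: st => [/eqP ->|st].
  rewrite subrr normr0 powR0; last by lra.
  by apply: integral0_eq => w _; rewrite subrr expr0n.
have r0 : 0 < s - t by lra.
have L V : measurable V -> _ := @fbm_increment_law t s V _ st _.
rewrite (@ge0_integral_law _ _ _ _ _ (fun x => (s - t) `^ alpha * x) _ _ _
  (fun x => (x ^+ 2)%:E))//.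
- under eq_integral do rewrite exprMn EFinM.
  rewrite integralZl//; last exact: integrable_normal_sqr.
  rewrite normal_var1 mule1 gtr0_norm// -powR_mulrn ?powR_ge0// -powRrM.
  by rewrite mulrC.
- exact: measurable_funB.
- exact: (@measurable_funM _ _ _ setT (cst _) id).
- by move=> V mV; apply: L => //; lra.
- by apply/measurable_EFinP; exact: (measurable_funX 2 (@measurable_id _ _ setT)).
- by move=> x; rewrite lee_fin sqr_ge0.
Qed.

Lemma fbm_increment_mean (s t : R) : 0 <= s <= 1 -> 0 <= t <= 1 ->
  P.-integrable setT (fun w => (B s w - B t w)%:E) /\
  (\int[P]_w (B s w - B t w)%:E = 0)%E.
Proof.
wlog st : s t / t <= s => [H|] s01 t01.
  have [st|st] := leP t s; first exact: H.
  have [//|||i1 i2] := H t s => //; first exact: ltW.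
  have E : (fun w => (B s w - B t w)%:E) = (fun w => ((-1)%:E * (B t w - B s w)%:E)%E).
    by apply/funext => w; rewrite -EFinM mulN1r opprB.
  rewrite E; split; first exact: integrableZl.
  by rewrite integralZl// i2 mule0.
rewrite le_eqVlt in st; case/orP: st => [/eqP ->|st].
  have E : (fun w => (B s w - B s w)%:E) = cst (0%:E : \bar R).
    by apply/funext => w; rewrite subrr.
  by rewrite E integral0; split => //; exact: integrable0.
have r0 : 0 < s - t by lra.
have i0 : N01.-integrable setT (fun x : R => (((s - t) `^ alpha)%:E * x%:E)%E).
  by apply: (@integrableZl _ (measurableTypeR R) _ N01 setT measurableT _ EFin); exact: integrable_normal_id.
have mg : measurable_fun setT (fun x : R => (s - t) `^ alpha * x).
  exact: (@measurable_funM _ _ _ setT (cst _) id).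
have mY : measurable_fun setT (fun w => B s w - B t w) by exact: measurable_funB.
have L V : measurable V -> P ((fun w => B s w - B t w) @^-1` V) =
  N01 ((fun x => (s - t) `^ alpha * x) @^-1` V).
  by move=> mV; apply: fbm_increment_law => //; lra.
split; first exact: (@integrable_law _ _ _ _ _ _ mY mg L id).
rewrite (@integral_law _ _ _ _ _ _ mY mg L id)//.
under eq_integral do rewrite EFinM.
by rewrite integralZl ?normal_mean0 ?mule0//; exact: integrable_normal_id.
Qed.

(** A balanced combination is centred, and its variance is a quadratic form in
    the variances of increments, known from [fbm_increment_variance]. *)
Lemma fbm_cos (n : nat) (t a : 'I_n -> R) :
  (forall i, 0 <= t i <= 1) -> \sum_i a i = 0 ->
  (\int[P]_w (cos (\sum_i a i * B (t i) w))%:E =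
   (expR (- ((- 2^-1 * \sum_i \sum_j a i * a j * `|t i - t j| `^ (2 * alpha))
       / 2)))%:E)%E.
Proof.
move=> t01 a0; case: (fbmB) => gp _ _ _ _.
have mY : measurable_fun setT (fun w => \sum_i a i * B (t i) w).
  by apply: measurable_sum => i; exact: measurable_funM.
apply: gaussian_cos => //.
- by apply: gp => i; rewrite /= in_itv/=.
- case: n t a t01 a0 mY => [|n] t a t01 a0 mY.
    by under eq_integral do rewrite big_ord0; rewrite integral0.
  have E w : (\sum_i a i * B (t i) w)%:E =
      (\sum_i (a i)%:E * (B (t i) w - B (t ord0) w)%:E)%E.
    under [RHS]eq_bigr do rewrite -EFinM mulrBr.
    by rewrite sumEFin sumrB -mulr_suml a0 mul0r subr0.
  under eq_integral do rewrite E.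
  rewrite (@integral_sum _ _ _ P setT measurableT _
    (fun i w => (a i)%:E * (B (t i) w - B (t ord0) w)%:E)%E).
    rewrite big1// => i _.
    have [i1 i2] := fbm_increment_mean (t01 i) (t01 ord0).
    by rewrite integralZl// i2 mule0.
  move=> i; have [i1 _] := fbm_increment_mean (t01 i) (t01 ord0).
  exact: integrableZl.
- rewrite (@integral_sqr_sum _ _ _ _ _ (fun i => B (t i))
    (fun i j => `|t i - t j| `^ (2 * alpha)))//.
  by move=> i j; exact: fbm_increment_variance.
Qed.

End fbm_increments.

(** * Quadratic forms, Gaussian sums and trigonometric kernels *)

Section quadratic_forms.
Context (R : realType).
Implicit Types (G : nat -> nat -> R) (m v : nat -> R).

Definition qform G (p : nat) m : R :=
  \sum_(i < p) \sum_(j < p) m i * m j * G i j.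

Definition scons (x : R) v : nat -> R := fun i => if i is j.+1 then v j else x.

(** The Gram matrix of the remaining vectors, projected off the first one. *)
Definition schur G : nat -> nat -> R :=
  fun i j => G i.+1 j.+1 - G i.+1 0%N * G 0%N j.+1 / G 0%N 0%N.

Definition cross G (p : nat) v : R := \sum_(i < p) v i * G i.+1 0%N.

Lemma qform_scons G (p : nat) x v : (forall i j, G i j = G j i) ->
  G 0%N 0%N != 0 ->
  qform G p.+1 (scons x v) =
  G 0%N 0%N * (x + cross G p v / G 0%N 0%N) ^+ 2 + qform (schur G) p v.
Proof.
move=> sG g0; rewrite /qform big_ord_recl /= big_ord_recl /=.
under [X in _ + X = _]eq_bigr do rewrite big_ord_recl /=.
rewrite big_split /=.
have -> : \sum_(i < p) x * v i * G 0%N (bump 0 i) = x * cross G p v.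
  rewrite mulr_sumr; apply: eq_bigr => i _.
  by rewrite sG mulrA.
have -> : \sum_(i < p) v i * x * G (bump 0 i) 0%N = x * cross G p v.
  rewrite mulr_sumr; apply: eq_bigr => i _.
  by rewrite /bump add1n; ring.
have -> : \sum_(i < p) \sum_(j < p) v i * v j * schur G i j =
  \sum_(i < p) \sum_(j < p) v i * v j * G i.+1 j.+1
   - cross G p v ^+ 2 / G 0%N 0%N.
  rewrite expr2 {1}/cross mulr_suml mulr_suml -sumrB; apply: eq_bigr => i _.
  rewrite /cross mulr_sumr mulr_suml -sumrB; apply: eq_bigr => j _.
  by rewrite /schur [G j.+1 0%N]sG; ring.
by rewrite /bump /=; under eq_bigr do under eq_bigr do rewrite !add1n; field.
Qed.

(** For a Gram matrix, [qform G k.+1 c] with [c k = 1] is the squared distance from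
    a combination of the first [k] vectors to the next one; the property bounds
    from below the pivots of Gaussian elimination, that is, the conditional
    variances of each variable given the preceding ones. *)
Definition pivots G (p : nat) (sigma : nat -> R) :=
  forall k c, (k < p)%N -> c k = 1 -> sigma k ^+ 2 <= qform G k.+1 c.

Lemma pivots_diag G p sigma : pivots G p.+1 sigma ->
  sigma 0%N ^+ 2 <= G 0%N 0%N.
Proof.
move=> /(_ 0%N (fun=> 1) isT erefl).
by rewrite /qform !big_ord_recl !big_ord0 !addr0 !mul1r.
Qed.

(** The optimal coefficient in front of the eliminated vector turns a value of the
    Schur complement into a value of the original form. *)
Lemma pivots_schur G p sigma : (forall i j, G i j = G j i) ->
  G 0%N 0%N != 0 -> pivots G p.+1 sigma ->
  pivots (schur G) p (fun i => sigma i.+1).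
Proof.
move=> sG g0 piv k c kp ck.
have := piv k.+1 (scons (- (cross G k.+1 c / G 0%N 0%N)) c) kp ck.
by rewrite qform_scons// addNr expr0n mulr0 add0r.
Qed.

Lemma schur_sym G : (forall i j, G i j = G j i) ->
  forall i j, schur G i j = schur G j i.
Proof.
move=> sG i j; rewrite /schur (sG i.+1 j.+1) (sG i.+1 0%N) (sG 0%N j.+1).
by ring.
Qed.

End quadratic_forms.

Section gaussian_sums.
Context (R : realType).

(** Up to a factor, a primitive of [x |-> expR (- (tau * `|x|))]: its increments
    dominate the terms of the two-sided geometric sum, which then telescopes. *)
Let Phi (tau x : R) : R :=
  if x <= 0 then expR (tau * x) else 2 - expR (- (tau * x)).

Let Phi_bounds tau x : 0 < tau -> 0 <= Phi tau x <= 2.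
Proof.
move=> t0; rewrite /Phi; case: ifPn => x0.
  by rewrite expR_ge0 /= (@le_trans _ _ 1)// ?ler1n// -expR0 ler_expR; nra.
rewrite -ltNge in x0; have := expR_ge0 (- (tau * x)).
have : expR (- (tau * x)) <= 1 by rewrite -expR0 ler_expR; nra.
by move=> ? ?; apply/andP; split; lra.
Qed.

Let Phi_step tau x : 0 < tau ->
  (1 - expR (- tau)) * expR (- (tau * `|x|)) <= Phi tau (x + 1) - Phi tau x.
Proof.
move=> t0; set q := expR (- tau).
have q0 : 0 < q by exact: expR_gt0.
have q1 : q < 1 by rewrite /q -expR0 ltr_expR oppr_lt0.
rewrite /Phi; case: ifPn => x1; last rewrite -ltNge in x1.
- have x0 : x <= 0 by lra.
  rewrite x0 ler0_norm// mulrN opprK mulrDr mulr1 expRD.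
  have e0 := expR_gt0 (tau * x).
  have : 1 <= expR tau * q by rewrite /q expRN mulfV// gt_eqF// expR_gt0.
  have : 1 < expR tau by rewrite -expR0 ltr_expR.
  move: (expR tau) => E E1 Eq.
  have h : 1 - q <= E - 1 by nra.
  by have := ler_wpM2r (ltW e0) h; lra.
- case: ifPn => x0; last rewrite -ltNge in x0.
  + rewrite ler0_norm// mulrN opprK mulrDr mulr1 opprD expRD -/q expRN.
    have a0 := expR_gt0 (tau * x); set a := expR (tau * x) in a0 *.
    have a1 : a <= 1 by rewrite /a -expR0 ler_expR; nra.
    have qa : q < a by rewrite /q /a ltr_expR; nra.
    have ai : a * a^-1 = 1 by rewrite mulfV// gt_eqF.
    have ai0 : 0 < a^-1 by rewrite invr_gt0.
    rewrite -(ler_pM2l a0).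
    have -> : a * (2 - a^-1 * q - a) = 2 * a - q * (a * a^-1) - a ^+ 2 by ring.
    have h : 0 <= 2 * a - q * (1 + a) by nra.
    have h1 : 0 <= 1 - a by lra.
    by rewrite ai; have := mulr_ge0 h1 h; lra.
  + rewrite gtr0_norm// mulrDr mulr1 opprD expRD -/q.
    have := expR_gt0 (- (tau * x)); nra.
Qed.

Lemma sum_two_sided_geometric (tau c : R) (N : nat) : 0 < tau ->
  \sum_(n < N) expR (- (tau * `|n%:R + c|)) <= 2 * (1 + tau^-1).
Proof.
move=> t0; set q := expR (- tau).
have q0 : 0 < q by exact: expR_gt0.
have q1 : q < 1 by rewrite /q -expR0 ltr_expR oppr_lt0.
have H : (1 - q) * \sum_(n < N) expR (- (tau * `|n%:R + c|)) <=
    Phi tau (N%:R + c) - Phi tau c.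
  elim: N => [|N IH]; first by rewrite big_ord0 mulr0 add0r subrr.
  rewrite big_ord_recr /= mulrDr.
  have := Phi_step (N%:R + c) t0; rewrite -/q => H.
  rewrite (_ : N.+1%:R + c = N%:R + c + 1); last by rewrite -natr1; ring.
  lra.
have /andP[_ b1] := Phi_bounds (N%:R + c) t0.
have /andP[b2 _] := Phi_bounds c t0.
have qt : tau <= (1 - q) * (1 + tau).
  suff : q * (1 + tau) <= 1 by nra.
  by rewrite /q expRN mulrC ler_pdivrMr ?expR_gt0// mul1r expR_ge1Dx.
have ti : tau * tau^-1 = 1 by rewrite mulfV// gt_eqF.
have ti0 : 0 < tau^-1 by rewrite invr_gt0.
have q10 : 0 < 1 - q by lra.
rewrite -(ler_pM2l q10); apply: le_trans H _.
suff : 1 <= (1 - q) * (1 + tau^-1) by nra.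
rewrite -(ler_pM2l t0) mulr1 mulrCA mulrDr mulr1 ti [tau + 1]addrC; exact: qt.
Qed.

(** [tau ^+ 2 * y ^+ 2 / 2 >= tau * `|y| - 2^-1] reduces this to a geometric sum. *)
Lemma sum_gaussian (tau c : R) (N : nat) : 0 < tau ->
  \sum_(n < N) expR (- (tau ^+ 2 * (n%:R + c) ^+ 2 / 2)) <= 4 * (1 + tau^-1).
Proof.
move=> t0.
apply: (@le_trans _ _ (2 * \sum_(n < N) expR (- (tau * `|n%:R + c|)))); last first.
  by have := sum_two_sided_geometric c N t0; lra.
rewrite mulr_sumr; apply: ler_sum => n _.
have e2 : expR (2^-1) <= 2 :> R.
  rewrite -[leLHS]invrK -expRN -[leRHS]invrK lef_pV2 ?posrE ?invr_gt0 ?expR_gt0//.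
  by apply: le_trans (expR_ge1Dx _); lra.
apply: (@le_trans _ _ (expR (2^-1) * expR (- (tau * `|n%:R + c|)))); last first.
  by rewrite ler_wpM2r// expR_ge0.
rewrite -expRD ler_expR -[(n%:R + c) ^+ 2]real_normK ?num_real//.
have := sqr_ge0 (tau * `|n%:R + c| - 1); move: (`|_|) => y; nra.
Qed.

End gaussian_sums.

Section trigonometric_kernel.
Context (R : realType).
Implicit Types (N p : nat).

(** The frequencies, with multiplicity, of a [p]-fold product of the kernel
    [trig_kernel N] below. *)
Fixpoint freqs N p : seq (nat -> R) :=
  if p is p'.+1 then
    [seq scons (q.1%:R - q.2%:R) v | q <- [seq (n, n') | n <- iota 0 N, n' <- iota 0 N],
       v <- freqs N p']
  else [:: fun=> 0].

Lemma big_freqs N p (F : (nat -> R) -> R) :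
  \sum_(v <- freqs N p.+1) F v =
  \sum_(n < N) \sum_(n' < N) \sum_(v <- freqs N p) F (scons (n%:R - n'%:R) v).
Proof.
rewrite /= big_allpairs_dep big_allpairs /=.
by rewrite -[N in iota 0 N]subn0 big_mkord; apply: eq_bigr => n _; rewrite big_mkord.
Qed.

Definition trig_kernel N (x : R) : R :=
  \sum_(n < N) \sum_(n' < N) cos ((n%:R - n'%:R) * x).

(** The kernel is the squared modulus of the sum of the [e^(i n x)], [n < N]. *)
Lemma trig_kernelE N x : trig_kernel N x =
  (\sum_(n < N) cos (n%:R * x)) ^+ 2 + (\sum_(n < N) sin (n%:R * x)) ^+ 2.
Proof.
rewrite !expr2 !mulr_suml -big_split; apply: eq_bigr => n _ /=.
rewrite !mulr_sumr -big_split; apply: eq_bigr => n' _ /=.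
by rewrite mulrBl cosB.
Qed.

Lemma trig_kernel_ge0 N x : 0 <= trig_kernel N x.
Proof. by rewrite trig_kernelE addr_ge0// sqr_ge0. Qed.

Lemma trig_kernel_lower N x : `|x| * N%:R <= 1 ->
  (N%:R * cos 1) ^+ 2 <= trig_kernel N x.
Proof.
move=> xN; rewrite trig_kernelE -[leLHS]addr0 lerD ?sqr_ge0//.
have H : N%:R * cos 1 <= \sum_(n < N) cos (n%:R * x).
  rewrite mulrC mulr_natr -[X in _ *+ X]card_ord -sumr_const.
  apply: ler_sum => n _; rewrite -(cos_norm (_ * x)).
  have n1 : `|n%:R * x| <= 1.
    rewrite normrM ger0_norm// mulrC; apply: le_trans xN.
    by rewrite ler_wpM2l// ler_nat ltnW.
  have pi1 : (1 : R) <= pi by apply: le_trans (pi_ge2 R); lra.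
  rewrite le_eqVlt; have [->|ne] := eqVneq `|n%:R * x| 1; first by rewrite eqxx.
  by rewrite ltr_cos ?in_itv/= ?normr_ge0 ?ler01 ?(le_trans n1)// lt_neqAle ne n1 orbT.
rewrite ler_sqr ?nnegrE//.
  by rewrite mulr_ge0// ltW// cos1_gt0.
by apply: le_trans H; rewrite mulr_ge0// ltW// cos1_gt0.
Qed.

Lemma sum_sin_antisym N x :
  \sum_(n < N) \sum_(n' < N) sin ((n%:R - n'%:R) * x) = 0 :> R.
Proof.
set S := LHS.
have : S = - S.
  rewrite {1}/S exchange_big /= -sumrN; apply: eq_bigr => n _.
  rewrite -sumrN; apply: eq_bigr => n' _.
  by rewrite -sinN -mulNr opprB.
lra.
Qed.

(** The free phase [phi] is what makes the induction on [p] go through. *)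
Lemma sum_cos_freqs N p (phi : R) (x : nat -> R) :
  \sum_(v <- freqs N p) cos (phi + \sum_(i < p) v i * x i) =
  cos phi * \prod_(i < p) trig_kernel N (x i).
Proof.
elim: p phi x => [|p IH] phi x.
  by rewrite /= big_seq1 !big_ord0 addr0 mulr1.
rewrite big_freqs big_ord_recl /=.
transitivity (\sum_(n < N) \sum_(n' < N)
   (cos (phi + (n%:R - n'%:R) * x 0%N) * \prod_(i < p) trig_kernel N (x i.+1))).
  apply: eq_bigr => n _; apply: eq_bigr => n' _; rewrite -(IH _ (fun i => x i.+1)).
  apply: eq_bigr => v _; rewrite big_ord_recl /= addrA.
  by congr (cos (_ + _)); apply: eq_bigr => i _; rewrite /bump add1n.
transitivity ((\sum_(n < N) \sum_(n' < N) cos (phi + (n%:R - n'%:R) * x 0%N)) *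
    \prod_(i < p) trig_kernel N (x i.+1)).
  by rewrite mulr_suml; apply: eq_bigr => n _; rewrite mulr_suml.
have -> : \prod_(i < p) trig_kernel N (x (bump 0 i)) =
    \prod_(i < p) trig_kernel N (x i.+1).
  by apply: eq_bigr => i _; rewrite /bump add1n.
rewrite mulrA; congr (_ * _).
transitivity (cos phi * trig_kernel N (x 0%N) -
   sin phi * (\sum_(n < N) \sum_(n' < N) sin ((n%:R - n'%:R) * x 0%N))).
  rewrite /trig_kernel !mulr_sumr -sumrB; apply: eq_bigr => n _.
  rewrite !mulr_sumr -sumrB; apply: eq_bigr => n' _.
  by rewrite cosD.
by rewrite sum_sin_antisym mulr0 subr0.
Qed.

(** Summing out the first coordinate leaves a Gaussian sum for the Schur
    complement: the completed square contributes a one-dimensional sum, whose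
    centre depends on the other coordinates but whose bound does not. *)
Lemma sum_gaussian_freqs N p (G : nat -> nat -> R) (sigma : nat -> R) (s : R) :
  0 < s -> (forall i j, G i j = G j i) -> (forall i, (i < p)%N -> 0 < sigma i) ->
  pivots G p sigma ->
  \sum_(v <- freqs N p) expR (- (s ^+ 2 * qform G p v / 2)) <=
  \prod_(i < p) (N%:R * (4 * (1 + (s * sigma i)^-1))).
Proof.
move=> s0; elim: p G sigma => [|p IH] G sigma sG sg piv.
  rewrite /= big_seq1 big_ord0 /qform big_ord0 mulr0 mul0r oppr0 expR0 //.
have g0 : 0 < G 0%N 0%N.
  by apply: lt_le_trans (pivots_diag piv); rewrite exprn_gt0// sg.
have g0' : G 0%N 0%N != 0 by rewrite gt_eqF.
have {}IH := IH (schur G) (fun i => sigma i.+1) (schur_sym sG) (fun i => sg i.+1)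
  (pivots_schur sG g0' piv).
rewrite big_freqs big_ord_recl.
have -> : \prod_(i < p) (N%:R * (4 * (1 + (s * sigma (lift ord0 i))^-1))) =
  \prod_(i < p) (N%:R * (4 * (1 + (s * sigma i.+1)^-1))).
  by apply: eq_bigr => i _; rewrite /= /bump add1n.
set A := N%:R * _; set D := \prod_(i < p) _ in IH *.
have A0 : 0 <= A.
  by rewrite /A mulr_ge0// mulr_ge0// addr_ge0// invr_ge0 mulr_ge0 ?(ltW s0)// ltW// sg.
rewrite exchange_big /=.
apply: (@le_trans _ _ (\sum_(n' < N) \sum_(v <- freqs N p)
    expR (- (s ^+ 2 * qform (schur G) p v / 2)) * (4 * (1 + (s * sigma 0%N)^-1)))).
  apply: ler_sum => n' _; rewrite exchange_big /=; apply: ler_sum => v _.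
  under eq_bigr do rewrite qform_scons// mulrDr mulrDl opprD expRD mulrC.
  rewrite -mulr_sumr ler_wpM2l ?expR_ge0//.
  have ss0 : 0 < s * sigma 0%N by rewrite mulr_gt0// sg.
  apply: le_trans (sum_gaussian (- n'%:R + cross G p v / G 0%N 0%N) N ss0).
  apply: ler_sum => n _; rewrite ler_expR lerN2 addrA ler_pM2r ?invr_gt0//.
  rewrite exprMn mulrA ler_wpM2r ?sqr_ge0// ler_wpM2l ?sqr_ge0//.
  exact: pivots_diag piv.
rewrite sumr_const card_ord -mulr_suml -[_ *+ N]mulr_natl.
have := ler_wpM2l A0 IH; rewrite /A /=.
set S := \sum_(_ <- _) _.
have -> : N%:R * (S * (4 * (1 + (s * sigma 0%N)^-1))) =
  N%:R * (4 * (1 + (s * sigma 0%N)^-1)) * S by ring.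
by [].
Qed.

End trigonometric_kernel.

(** * Small balls of Gaussian vectors *)

Section small_ball.
Context (d : measure_display) (T : measurableType d) (R : realType)
  (P : probability T R).
Variables (p : nat) (X : nat -> T -> R) (G : nat -> nat -> R) (sigma : nat -> R).
Hypotheses (mX : forall i, measurable_fun setT (X i))
  (sG : forall i j, G i j = G j i)
  (sigma_gt0 : forall i, (i < p)%N -> 0 < sigma i)
  (pivG : pivots G p sigma)
  (charX : forall m : nat -> R,
    (\int[P]_w (cos (\sum_(i < p) m i * X i w))%:E =
     (expR (- (qform G p m / 2)))%:E)%E).

Definition small_ball_const : R := 8 / cos 1 ^+ 2.

Let ball (r : R) := [set w | forall i, (i < p)%N -> `|X i w| <= r].

Lemma measurable_small_ball r : measurable (ball r).
Proof.
rewrite (_ : ball r = \bigcap_(i in `I_p) [set w | `|X i w| <= r]); last first.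
  by apply/seteqP; split => w /= H i; exact: H.
apply: bigcap_measurableType => i _.
have mf : measurable_fun setT (fun w => `|X i w| <= r).
  by apply: measurable_fun_ler => //; exact: measurableT_comp.
by rewrite -[X in measurable X]setTI; exact: (mf measurableT [set true]).
Qed.

(** The indicator of a small ball is dominated by a product of trigonometric
    kernels, whose expectation is a finite sum of values of the characteristic
    function. This takes the place of a bound on the joint density. *)
Lemma small_ball (r : R) : 0 < r ->
  (P (ball r) <= (\prod_(i < p) (small_ball_const * (r / sigma i)))%:E)%E.
Proof.
move=> r0.
have c1 : (0 : R) < cos 1 := cos1_gt0 R.
(* large enough that the kernel resolves every [sigma i] *)
have [N [N0 Nsig]] : exists N : nat, (0 < N)%N /\
    forall i, (i < p)%N -> sigma i <= N%:R * r.
  exists (\max_(i < p) (Num.truncn (sigma i / r)).+1).+1; split => // i ip.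
  rewrite -ler_pdivrMr//; apply: le_trans (ltW (truncnS_gt _)) _.
  rewrite ler_nat; apply: leqW.
  exact: (leq_bigmax (F := fun i : 'I_p => (Num.truncn (sigma i / r)).+1) (Ordinal ip)).
have N0R : (0 : R) < N%:R by rewrite ltr0n.
pose s := (N%:R * r)^-1; have s0 : 0 < s by rewrite invr_gt0 mulr_gt0.
pose D w := \prod_(i < p) trig_kernel N (s * X i w).
have mX' i : measurable_fun setT (X i) by exact: mX.
have mcos (v : nat -> R) : measurable_fun setT (fun w => cos (\sum_(i < p) v i * (s * X i w))).
  apply: (@measurableT_comp _ _ _ _ _ _ (@cos R)).
    by apply: continuous_measurable_fun; exact: continuous_cos.
  apply: measurable_sum => i; apply: measurable_funM => //.
  exact: measurable_funM.
have ED w : D w = \sum_(v <- freqs R N p) cos (\sum_(i < p) v i * (s * X i w)).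
  have := sum_cos_freqs N p 0 (fun i => s * X i w).
  rewrite cos0 mul1r /D /= => <-; apply: eq_bigr => v _; by rewrite add0r.
have mD : measurable_fun setT D.
  rewrite (_ : D = fun w => \sum_(v <- freqs R N p) cos (\sum_(i < p) v i * (s * X i w))); last exact/funext.
  by apply: measurable_sum.
have D0 w : 0 <= D w by apply: prodr_ge0 => i _; exact: trig_kernel_ge0.
pose L : R := \prod_(i < p) (N%:R * cos 1) ^+ 2.
have L0 : 0 < L by apply: prodr_gt0 => i _; rewrite exprn_gt0// mulr_gt0.
have mball := measurable_small_ball r.
have H1 : (L%:E * P (ball r) <= \int[P]_w (D w)%:E)%E.
  rewrite -[ball r]setIT -integral_indic// -ge0_integralZl//; last 2 first.
  - exact/measurable_EFinP/measurable_indic.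
  - by rewrite lee_fin ltW.
  apply: ge0_le_integral => //.
  - by move=> w _; rewrite mule_ge0// lee_fin ltW.
  - by apply: measurable_funeM; exact/measurable_EFinP/measurable_indic.
  - exact/measurable_EFinP.
  move=> w _; rewrite -EFinM lee_fin indicE.
  have [wb|_] := boolP (w \in ball r); last by rewrite mulr0.
  rewrite mulr1 /L /D; apply: ler_prod => i _; rewrite sqr_ge0 /=.
  apply: trig_kernel_lower; rewrite normrM gtr0_norm// /s.
  rewrite invfM mulrC mulrA mulrA mulfV ?gt_eqF// mul1r mulrC ler_pdivrMr// mul1r.
  by move/set_mem: wb; apply.
have H2 : (\int[P]_w (D w)%:E =
    (\sum_(v <- freqs R N p) expR (- (s ^+ 2 * qform G p v / 2)))%:E)%E.
  under eq_integral do rewrite ED -sumEFin.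
  rewrite (@integral_sum _ _ _ P setT measurableT _
    (fun (v : nat -> R) w => (cos (\sum_(i < p) v i * (s * X i w)))%:E)); last first.
    move=> v; apply: (@le_integrable _ _ _ P setT measurableT _ (cst 1%:E)) => //.
    - exact/measurable_EFinP.
    - by move=> w _ /=; rewrite lee_fin normr1 cos_max.
    - exact: finite_measure_integrable_cst.
  rewrite -sumEFin; apply: eq_bigr => v _.
  have E w : \sum_(i < p) v i * (s * X i w) = \sum_(i < p) v i * s * X i w.
    by apply: eq_bigr => i _; rewrite mulrA.
  under eq_integral do rewrite E.
  have := charX (fun i => v i * s); rewrite /=.
  move=> ->; congr ((expR (- (_ / 2)))%:E).
  rewrite /qform mulr_sumr; apply: eq_bigr => i _.
  by rewrite mulr_sumr; apply: eq_bigr => j _; ring.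
have H3 := sum_gaussian_freqs N s0 sG sigma_gt0 pivG.
have H4 : \prod_(i < p) (N%:R * (4 * (1 + (s * sigma i)^-1))) <=
    L * \prod_(i < p) (small_ball_const * (r / sigma i)).
  rewrite /L -big_split /=; apply: ler_prod => i _.
  have si := sigma_gt0 (ltn_ord i).
  have := Nsig _ (ltn_ord i).
  rewrite /s /small_ball_const invfM invrK => Ns.
  have u1 : 1 <= N%:R * r * (sigma i)^-1.
    by rewrite ler_pdivlMr// mul1r.
  apply/andP; split.
    by rewrite mulr_ge0// mulr_ge0//; lra.
  have -> : (N%:R * cos 1) ^+ 2 * (8 / cos 1 ^+ 2 * (r / sigma i)) =
     N%:R * (8 * (N%:R * r * (sigma i)^-1)).
    by field; rewrite !gt_eqF.
  by rewrite ler_wpM2l//; lra.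
rewrite H2 in H1.
have LE : (L%:E * P (ball r) <= L%:E * (\prod_(i < p) (small_ball_const * (r / sigma i)))%:E)%E.
  by apply: le_trans H1 _; rewrite -EFinM lee_fin; exact: le_trans H3 H4.
by rewrite lee_pmul2l in LE.
Qed.

End small_ball.

(** * Small balls of fractional Brownian motion *)

Section fbm_small_ball.
Context (d : measure_display) (T : measurableType d) (R : realType)
  (P : probability T R) (alpha : R) (B : R -> {RV P >-> R}).
Hypotheses (alpha01 : 0 < alpha < 1)
  (fbmB : fractional_brownian_motion `[0, 1] alpha B).

(** The covariances of the increments from index [0], when [V] gives the variances
    of the increments between two times. *)
Definition increment_gram (V : nat -> nat -> R) (i j : nat) : R :=
  2^-1 * (V i.+1 0%N + V 0%N j.+1 - V i.+1 j.+1).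

(** The coefficient put on index [0] makes the weights balanced. *)
Lemma qform_increment_gram (V : nat -> nat -> R) (p : nat) (m : nat -> R) :
  V 0%N 0%N = 0 ->
  let a := scons (- \sum_(i < p) m i) m in
  qform (increment_gram V) p m =
  - 2^-1 * \sum_(i < p.+1) \sum_(j < p.+1) a i * a j * V i j.
Proof.
move=> V0 a; set S := \sum_(i < p) m i.
pose U := \sum_(i < p) m i * V i.+1 0%N.
pose W := \sum_(j < p) m j * V 0%N j.+1.
pose Q := \sum_(i < p) \sum_(j < p) m i * m j * V i.+1 j.+1.
have E1 : qform (increment_gram V) p m = 2^-1 * (U * S + S * W - Q).
  rewrite /qform /U /S /W /Q mulr_suml mulr_suml -big_split /= -sumrB mulr_sumr.
  apply: eq_bigr => i _; rewrite !mulr_sumr -big_split /= -sumrB mulr_sumr.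
  by apply: eq_bigr => j _; rewrite /increment_gram; ring.
have E2 : \sum_(i < p.+1) \sum_(j < p.+1) a i * a j * V i j =
    - S * W - S * U + Q.
  rewrite big_ord_recl /= big_ord_recl /= V0 mulr0 add0r.
  have -> : \sum_(i < p) - S * m i * V 0%N (bump 0 i) = - S * W.
    by rewrite mulr_sumr; apply: eq_bigr => i _; rewrite /bump add1n mulrA.
  rewrite -addrA; congr (_ + _).
  rewrite /Q /U -mulNr mulr_sumr -big_split /=; apply: eq_bigr => i _.
  rewrite big_ord_recl /= -/S; congr (_ + _); first by rewrite /bump add1n add0n; ring.
by rewrite E1 E2; ring.
Qed.

Definition fbm_ball_const : R :=
  small_ball_const R / Num.sqrt (4 * mvn_const alpha)^-1.

Let c0_gt0 : 0 < (4 * mvn_const alpha)^-1.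
Proof. by rewrite invr_gt0 mulr_gt0// mvn_const_gt0. Qed.

Lemma fbm_ball_const_gt0 : 0 < fbm_ball_const.
Proof.
by rewrite /fbm_ball_const /small_ball_const !divr_gt0// ?sqrtr_gt0// exprn_gt0// cos1_gt0.
Qed.

(** Local nondeterminism says that the conditional variance of each value is at
    least a multiple of its time gap to the preceding one, to the power
    [2 * alpha]. *)
Lemma fbm_small_ball (p : nat) (x : nat -> R) (r : R) :
  (forall i, (i <= p)%N -> 0 <= x i <= 1) ->
  (forall i, (i < p)%N -> x i < x i.+1) -> 0 < r ->
  measurable [set w | forall i, (i < p)%N -> `|B (x i.+1) w - B (x 0%N) w| <= r]
  /\ (P [set w | forall i, (i < p)%N -> (`|B (x i.+1) w - B (x 0%N) w| <= r)%R] <=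
   (\prod_(i < p) (fbm_ball_const * (r / (x i.+1 - x i) `^ alpha)))%:E)%E.
Proof.
move=> x01 xincr r0; have /andP[a0 a1] := alpha01.
pose X (i : nat) (w : T) : R := B (x i.+1) w - B (x 0%N) w.
pose V (i j : nat) := `|x i - x j| `^ (2 * alpha).
have V0 : V 0%N 0%N = 0 by rewrite /V subrr normr0 powR0//; lra.
have Vs i j : V i j = V j i by rewrite /V distrC.
have mX i : measurable_fun setT (X i) by exact: measurable_funB.
have xmono i k : (i <= k)%N -> (k <= p)%N -> x i <= x k.
  elim: k => [|k IH]; first by rewrite leqn0 => /eqP ->.
  rewrite leq_eqVlt => /orP[/eqP ->//|ik kp].
  by apply: le_trans (IH ik (ltnW kp)) _; exact/ltW/xincr.
pose sigma i := Num.sqrt (4 * mvn_const alpha)^-1 * (x i.+1 - x i) `^ alpha.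
have sc0 : 0 < Num.sqrt (4 * mvn_const alpha)^-1 by rewrite sqrtr_gt0.
have rho0 i : (i < p)%N -> 0 < x i.+1 - x i.
  by move=> ip; rewrite subr_gt0; exact: xincr.
have sig0 i : (i < p)%N -> 0 < sigma i.
  by move=> ip; rewrite mulr_gt0// powR_gt0// rho0.
have sG i j : increment_gram V i j = increment_gram V j i.
  by rewrite /increment_gram (Vs i.+1 j.+1) (Vs i.+1 0%N) (Vs 0%N j.+1) [X in X - _]addrC.
have piv : pivots (increment_gram V) p sigma.
  move=> k c kp ck; rewrite qform_increment_gram// /sigma exprMn sqr_sqrtr ?(ltW c0_gt0)//.
  rewrite -powR_mulrn ?powR_ge0// -powRrM [alpha * _]mulrC.
  have := @local_nondeterminism _ _ alpha01 k.+1 x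
    (scons (- \sum_(i < k.+1) c i) c) (x k.+1 - x k).
  rewrite /V /=; apply=> //.
  - exact: rho0.
  - move=> i; rewrite ltnS => ik; rewrite opprB addrC subrK.
    by apply: xmono => //; exact: ltnW.
  - rewrite big_ord_recl /= addrC; apply/eqP; rewrite subr_eq0; apply/eqP.
    by apply: eq_bigr => i _; rewrite ?/bump ?add1n ?add0n.
have charX (m : nat -> R) : (\int[P]_w (cos (\sum_(i < p) m i * X i w))%:E =
     (expR (- (qform (increment_gram V) p m / 2)))%:E)%E.
  rewrite qform_increment_gram//.
  pose a := scons (- \sum_(i < p) m i) m.
  have sa : \sum_(i < p.+1) a i = 0.
    rewrite big_ord_recl /= addrC; apply/eqP; rewrite subr_eq0; apply/eqP.
    by apply: eq_bigr => i _; rewrite ?/bump ?add1n ?add0n.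
  rewrite -(@fbm_cos _ _ _ _ _ _ alpha01 fbmB _ (fun i : 'I_p.+1 => x i)
    (fun i : 'I_p.+1 => a i))//; last by move=> i; apply: x01; rewrite -ltnS.
  apply: eq_integral => w _; congr ((cos _)%:E).
  rewrite big_ord_recl /= mulNr mulr_suml addrC -sumrB.
  by apply: eq_bigr => i _; rewrite ?/bump ?add1n ?add0n /X mulrBr.
split; first exact: (@measurable_small_ball _ _ _ p X mX r).
apply: le_trans (@small_ball _ _ _ P p X (increment_gram V) sigma mX sG sig0 piv charX r r0) _.
rewrite lee_fin le_eqVlt; apply/orP; left; apply/eqP.
apply: eq_bigr => i _; have := rho0 i (ltn_ord i) => ri.
by rewrite /fbm_ball_const /sigma invfM; ring.
Qed.

End fbm_small_ball.

(** * Chains and their weights *)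

Section chains.

(** Deciding first whether [a.+1] belongs to the sequence makes the count of these
    increasing sequences follow Pascal's rule. *)
Fixpoint chains (p a l : nat) : seq (seq nat) :=
  match p, l with
  | 0, _ => [:: [::]]
  | _.+1, 0 => [::]
  | p'.+1, l'.+1 => [seq a.+1 :: s | s <- chains p' a.+1 l'] ++ chains p a.+1 l'
  end.

Lemma count_chains (D : pred nat) (p a l : nat) :
  count (all D) (chains p a l) = 'C(count D (iota a.+1 l), p).
Proof.
elim: l p a => [|l IH] [|p] a //; first by rewrite /= bin0.
rewrite /= count_cat count_map IH.
have -> : count (preim (cons a.+1) (all D)) (chains p a.+1 l) =
    (D a.+1 * 'C(count D (iota a.+2 l), p))%N.
  rewrite -IH; case: (boolP (D a.+1)) => Da; rewrite ?mul1n ?mul0n.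
    by apply: eq_count => s /=; rewrite Da.
  by apply/eqP; rewrite -leqn0 leqNgt -has_count; apply/hasPn => s _ /=; rewrite (negbTE Da).
by case: (D a.+1); rewrite ?add0n ?mul0n ?mul1n ?add1n ?binS ?add0n// addnC.
Qed.

Lemma chains_spec (p a l : nat) (s : seq nat) : s \in chains p a l ->
  [/\ size s = p, path ltn a s & all (fun b => b <= a + l)%N s].
Proof.
elim: l p a s => [|l IH] [|p] a s //=; try by rewrite inE => /eqP ->.
rewrite mem_cat => /orP[/mapP[s' s's ->]|/IH[sz ps al]].
  have [sz ps al] := IH _ _ _ s's.
  split => /=; [by rewrite sz|by rewrite ltnSn|].
  by rewrite addnS -addSn leq_addr.
split => //.
  case: s sz ps al => // b s _ /= /andP[ab ps] _.
  by rewrite ps andbT; exact: ltn_trans ab.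
by apply: sub_all al => b; rewrite addSn addnS.
Qed.

Fixpoint chain_weight (R : realFieldType) (w : nat -> R) (a : nat) (s : seq nat) : R :=
  if s is b :: s' then w (b - a)%N * chain_weight w b s' else 1.

Lemma chain_weightE (R : realFieldType) (w : nat -> R) (a : nat) (s : seq nat) :
  chain_weight w a s =
  \prod_(i < size s) w (nth 0%N (a :: s) i.+1 - nth 0%N (a :: s) i)%N.
Proof.
elim: s a => [|b s IH] a; first by rewrite big_ord0.
by rewrite /= big_ord_recl /= IH.
Qed.

(** A chain is determined by its gaps, so the sum is part of the expansion of a
    power. *)
Lemma sum_chain_weight (R : realFieldType) (w : nat -> R) (L p a l : nat) :
  (forall g, 0 <= w g) -> (l <= L)%N ->
  \sum_(s <- chains p a l) chain_weight w a s <=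
  (\sum_(1 <= g < L.+1) w g) ^+ p.
Proof.
move=> w0; set S := \sum_(_ <= _ < _) _.
have S0 : 0 <= S by apply: sumr_ge0.
elim: p a l => [|p IH] a l lL.
  by rewrite (_ : chains 0 a l = [:: [::]]) ?big_seq1 ?expr0//; case: l lL.
have step l' b : (l' <= L)%N -> \sum_(s <- chains p.+1 b l') chain_weight w a s <=
    (\sum_(c <- iota b.+1 l') w (c - a)%N) * S ^+ p.
  elim: l' b => [|l' IHl] b l'L; first by rewrite /= !big_nil mul0r.
  rewrite /= big_cat big_map big_cons mulrDl lerD//.
    rewrite -mulr_sumr ler_wpM2l//; exact/IH/ltnW.
  exact/IHl/ltnW.
apply: le_trans (step l a lL) _.
rewrite exprS ler_wpM2r ?exprn_ge0//.
rewrite (_ : \sum_(c <- iota a.+1 l) w (c - a)%N = \sum_(1 <= g < l.+1) w g); last first.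
  rewrite /index_iota subSS subn0 -[a.+1]addn1 iotaDl big_map.
  by apply: eq_bigr => i _; rewrite addKn.
rewrite /S [leRHS](big_cat_nat (n := l.+1))//= lerDl.
by apply: sumr_ge0.
Qed.

End chains.

Lemma bin_lower_bound (z p : nat) : ((z - p) ^ p <= 'C(z, p) * p`!)%N.
Proof.
rewrite bin_ffact; elim: p z => [|p IH] z; first by rewrite expn0 ffactn0.
case: z => [|z]; first by rewrite sub0n exp0n.
rewrite ffactnS expnS; apply: leq_mul; first exact: leq_subr.
by rewrite subSS; exact: IH.
Qed.

Section power_sums.
Context (R : realType).

(** Young's inequality with conjugate exponents [c^-1] and [(1 - c)^-1]. *)
Lemma powR_bernoulli (c u : R) : 0 < c -> c < 1 -> 0 <= u <= 1 ->
  (1 - u) `^ c <= 1 - c * u.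
Proof.
move=> c0 c1 /andP[u0 u1].
have := @conjugate_powR _ ((1 - u) `^ c) 1 c^-1 (1 - c)^-1.
rewrite mulr1 powR1 !invrK mul1r -powRrM divff ?gt_eqF// powRr1 ?subr_ge0// => H.
apply: le_trans (H _ _ _ _ _) _ => //.
- exact: powR_ge0.
- by rewrite invr_gt0.
- by rewrite invr_gt0 subr_gt0.
- by rewrite addrC subrK.
- lra.
Qed.

(** Comparison with the telescoping sum of [g%:R `^ (1 - alpha)]. *)
Lemma sum_powR_neg (alpha : R) (l : nat) : 0 < alpha -> alpha < 1 ->
  \sum_(1 <= g < l.+1) (g%:R : R) `^ (- alpha) <= (1 - alpha)^-1 * l%:R `^ (1 - alpha).
Proof.
move=> a0 a1; elim: l => [|l IH].
  by rewrite big_geq// mulr_ge0 ?powR_ge0// invr_ge0 subr_ge0 ltW.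
rewrite big_nat_recr//= ; apply: le_trans (lerD IH (lexx _)) _.
have b0 : 0 < 1 - alpha by lra.
have n0 : (0 : R) < l.+1%:R by rewrite ltr0n.
have := @powR_bernoulli (1 - alpha) l.+1%:R^-1 b0.
have -> : 1 - l.+1%:R^-1 = l%:R / l.+1%:R :> R.
  by rewrite -[l.+1%:R]natr1; field; rewrite natr1 gt_eqF.
move=> H.
have {}H : (l%:R / l.+1%:R) `^ (1 - alpha) <= 1 - (1 - alpha) * l.+1%:R^-1 :> R.
  apply: H; first by lra.
  by rewrite invr_ge0 ltW//= invf_le1// ler1n.
rewrite powRM ?invr_ge0// ?(ltW n0)// in H.
have pn0 : 0 < (l.+1%:R : R) `^ (1 - alpha) by rewrite powR_gt0.
have e1 : (l.+1%:R : R) `^ (- alpha) = l.+1%:R `^ (1 - alpha) * l.+1%:R^-1.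
  rewrite -powR_inv1 ?(ltW n0)// -powRD ?(gt_eqF n0) ?implybT//.
  by congr (_ `^ _); ring.
have e2 : (l.+1%:R : R)^-1 `^ (1 - alpha) * l.+1%:R `^ (1 - alpha) = 1.
  by rewrite -powRM ?invr_ge0 ?(ltW n0)// mulVf ?gt_eqF// powR1.
rewrite -(ler_pM2r pn0) in H.
rewrite -mulrA e2 mulr1 in H.
rewrite -(ler_pM2l b0) mulrDr !mulrA !mulfV ?gt_eqF// !mul1r e1.
move: H e2; move: (_ `^ _) (_ `^ _) (_^-1) => *; nra.
Qed.

End power_sums.

(** * A Borel-Cantelli lemma *)

Section borel_cantelli_tools.
Context (d : measure_display) (T : measurableType d) (R : realType)
  (P : probability T R).

Lemma measure_finite_union (I : Type) (s : seq I) (c : pred I) (A : I -> set T) :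
  (forall i, c i -> measurable (A i)) ->
  (P (\big[setU/set0]_(i <- s | c i) A i) <= \sum_(i <- s | c i) P (A i))%E.
Proof.
move=> mA; elim: s => [|i s IH]; first by rewrite !big_nil measure0.
rewrite !big_cons; case: ifPn => // ci.
apply: le_trans (leeD2l _ IH); apply: measureU2; first exact: mA.
by apply: bigsetU_measurable => j cj; exact: mA.
Qed.

Lemma borel_cantelli_geometric (F : nat -> set T) (C : R) (n0 : nat) :
  (forall n, (n0 <= n)%N -> measurable (F n) /\ (P (F n) <= (C * 2^-1 ^+ n)%:E)%E) ->
  {ae P, forall w, exists n1, forall n, (n1 <= n)%N -> ~ F n w}.
Proof.
move=> H; pose F' n := F (n0 + n)%N.
have mF' n : measurable (F' n) by case: (H _ (leq_addr n n0)).
have C0 : 0 <= C.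
  have [_ h] := H n0 (leqnn _).
  have : (0 <= (C * 2^-1 ^+ n0)%:E)%E by apply: le_trans h; exact: measure_ge0.
  by rewrite lee_fin pmulr_lge0// exprn_gt0// invr_gt0.
have fin : (\sum_(n <oo) P (F' n) < +oo)%E.
  apply: (@le_lt_trans _ _ (2 * C)%:E); last by rewrite ltry.
  apply: lime_le.
    by apply: is_cvg_nneseries => n _ _; exact: measure_ge0.
  apply: nearW => n.
  apply: (@le_trans _ _ (\sum_(0 <= i < n) (C * 2^-1 ^+ i)%:E)%E).
    apply: lee_sum => i _; have [_ h] := H _ (leq_addr i n0).
    apply: le_trans h _; rewrite lee_fin ler_wpM2l// exprD ler_piMl ?exprn_ge0 ?invr_ge0//.
    by rewrite exprn_ile1// ?invr_ge0// invf_le1// ler1n.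
  rewrite sumEFin lee_fin -mulr_sumr mulrC ler_wpM2r//.
  suff : \sum_(0 <= i < n) (2^-1 : R) ^+ i <= 2 - 2^-1 ^+ n * 2.
    move=> h; apply: le_trans h _; rewrite lerBlDr lerDl mulr_ge0// exprn_ge0// invr_ge0//.
  elim: n => [|n IH]; first by rewrite big_geq// expr0 mul1r subrr.
  by rewrite big_nat_recr//= exprS; lra.
have z := lim_sup_set_cvg0 mF' fin.
exists (lim_sup_set F'); split => //.
  apply: bigcap_measurableType => n _; exact: bigcup_measurable.
move=> w /= nw n _; apply: contrapT => h; apply: nw.
exists (n0 + n)%N => k nk Fk; apply: h; exists (k - n0)%N => /=.
  by rewrite leq_subRL// (leq_trans _ nk)// leq_addr.
by rewrite /F' subnKC// (leq_trans _ nk)// leq_addr.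
Qed.

End borel_cantelli_tools.

(** * Increments along the grid *)

Section grid.
Context (R : realType) (M : nat).
Hypothesis M2 : (2 <= M)%N.

Definition grid (n i : nat) : R := i%:R / (M ^ n)%:R.

Lemma Mn_gt0 n : (0 : R) < (M ^ n)%:R.
Proof. by rewrite ltr0n expn_gt0 (leq_trans _ M2). Qed.

Lemma M_gt0 : (0 : R) < M%:R.
Proof. by rewrite ltr0n (leq_trans _ M2). Qed.

Lemma M_ge1 : (1 : R) <= M%:R.
Proof. by rewrite ler1n (leq_trans _ M2). Qed.

Lemma Mn_powR n : (M ^ n)%:R = M%:R `^ n%:R :> R.
Proof. by rewrite powR_mulrn ?ler0n// natrX. Qed.

Lemma powR_MD (x y : R) : M%:R `^ (x + y) = M%:R `^ x * M%:R `^ y.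
Proof. by rewrite powRD ?(gt_eqF M_gt0) ?implybT. Qed.

Lemma powR_M_gt0 (x : R) : 0 < M%:R `^ x.
Proof. by rewrite powR_gt0// M_gt0. Qed.

Lemma ler_powR_M (x y : R) : x <= y -> M%:R `^ x <= M%:R `^ y.
Proof. by apply: ler_powR; exact: M_ge1. Qed.

Lemma powR_MN_le n : M%:R `^ (- n%:R) <= 2^-1 ^+ n :> R.
Proof.
rewrite powRN -Mn_powR natrX -exprVn; apply: lerXn2r; rewrite ?nnegrE ?invr_ge0//.
by rewrite lef_pV2 ?posrE ?M_gt0// ler_nat.
Qed.

Lemma grid01 n i : (i <= M ^ n)%N -> 0 <= grid n i <= 1.
Proof.
move=> iM; rewrite divr_ge0//= /grid ler_pdivrMr ?Mn_gt0// mul1r ler_nat//.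
Qed.

Lemma gridB n i j : (j <= i)%N -> grid n i - grid n j = (i - j)%:R / (M ^ n)%:R.
Proof. by move=> ji; rewrite /grid -mulrBl natrB. Qed.

Lemma grid_lt n i j : (j < i)%N -> grid n j < grid n i.
Proof. by move=> ji; rewrite ltr_pM2r ?invr_gt0 ?Mn_gt0// ltr_nat. Qed.

Definition returns (f : R -> R) (n : nat) (r : R) (i0 l : nat) : nat :=
  count (fun i => `|f (grid n (i0 + i)) - f (grid n i0)| <= r) (iota 1 l).

End grid.

Section fbm_paths.
Context (d : measure_display) (T : measurableType d) (R : realType)
  (P : probability T R) (alpha : R) (B : R -> {RV P >-> R}) (M : nat).
Hypotheses (alpha01 : 0 < alpha < 1)
  (fbmB : fractional_brownian_motion `[0, 1] alpha B) (M2 : (2 <= M)%N).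
Notation q := (M%:R : R).

Lemma expRN_le_powR (k : nat) (y : R) : (0 < k)%N -> 0 < y ->
  expR (- y) <= (k%:R / y) ^+ k.
Proof.
move=> k0 y0; have k0R : (0 : R) < k%:R by rewrite ltr0n.
have u0 : 0 < y / k%:R by rewrite divr_gt0.
have -> : (k%:R / y) ^+ k = ((y / k%:R) ^+ k)^-1 by rewrite -exprVn invf_div.
rewrite expRN lef_pV2 ?posrE ?expR_gt0 ?exprn_gt0//.
rewrite [in leRHS](_ : y = k%:R * (y / k%:R)); last by rewrite mulrCA divff ?mulr1// gt_eqF.
rewrite expRM_natl; apply: lerXn2r; rewrite ?nnegrE ?expR_ge0 ?(ltW u0)//.
by apply: le_trans (expR_ge1Dx _); lra.
Qed.

(** A union bound over the grid: at this threshold, the Gaussian tails are smaller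
    than any negative power of [M ^ n]. *)
Lemma fbm_grid_increments (eps : R) : 0 < eps ->
  {ae P, forall w, exists n0, forall n, (n0 <= n)%N -> forall i, (i < M ^ n)%N ->
    `|B (grid R M n i.+1) w - B (grid R M n i) w| <= q `^ (- (n%:R * (alpha - eps)))}.
Proof.
move=> e0.
pose lam n := q `^ (n%:R * eps).
pose A n i := [set w | (lam n * (grid R M n i.+1 - grid R M n i) `^ alpha <
   `|B (grid R M n i.+1) w - B (grid R M n i) w|)%R].
have mA n i : measurable (A n i).
  have mf : measurable_fun setT (fun w => lam n * (grid R M n i.+1 - grid R M n i) `^ alpha <
      `|B (grid R M n i.+1) w - B (grid R M n i) w|).
    apply: measurable_fun_ltr => //.
    by apply: measurableT_comp => //; exact: measurable_funB.
  by rewrite -[X in measurable X]setTI; exact: (mf measurableT [set true]).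
pose F n := \big[setU/set0]_(i < M ^ n) A n i.
pose k := (Num.truncn eps^-1).+1.
have k0 : (0 < k)%N by [].
have ek : 1 <= eps * k%:R.
  by rewrite -ler_pdivrMl// mulr1 ltW// truncnS_gt.
have [c [c0 ck]] : exists c : R, 0 <= c /\ c = 4 * k%:R.
  by exists (4 * k%:R); split => //; rewrite mulr_ge0.
pose C : R := 2 * c ^+ k.
have C0 : 0 <= C by rewrite /C mulr_ge0// exprn_ge0.
have PF n : (P (F n) <= (C * 2^-1 ^+ n)%:E)%E.
  apply: le_trans (measure_finite_union _ _ _) _ => //.
  apply: (@le_trans _ _ (\sum_(i < M ^ n) (2 * expR (- (lam n ^+ 2 / 4)))%:E)%E).
    apply: lee_sum => i _; apply: fbm_increment_tail => //.
    - by have /andP[] := grid01 R M2 (ltnW (ltn_ord i)).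
    - exact: grid_lt.
    - by have /andP[] := grid01 R M2 (ltn_ord i).
    - exact: powR_ge0.
  rewrite sumEFin lee_fin sumr_const card_ord -[_ *+ (M ^ n)]mulr_natl.
  have lg : 0 < lam n by exact: powR_M_gt0.
  have y0 : 0 < lam n ^+ 2 / 4 by rewrite divr_gt0// exprn_gt0.
  have := expRN_le_powR k0 y0.
  rewrite (_ : k%:R / (lam n ^+ 2 / 4) = c * (lam n ^+ 2)^-1); last first.
    by rewrite ck; field; rewrite gt_eqF.
  rewrite exprMn => h.
  have l2 : (lam n ^+ 2)^-1 ^+ k <= q `^ (- (2 * n%:R)).
    rewrite -exprVn -exprM -[lam n]/(q `^ (n%:R * eps)) -powRN.
    rewrite -powR_mulrn ?powR_ge0// -powRrM; apply: ler_powR_M => //.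
    rewrite natrM; have := ler_wpM2l (ler0n R n) ek; lra.
  apply: (@le_trans _ _ ((M ^ n)%:R * (2 * (c ^+ k * q `^ (- (2 * n%:R)))))).
    rewrite ler_wpM2l// ler_wpM2l//; apply: le_trans h _.
    by rewrite ler_wpM2l// exprn_ge0.
  rewrite (_ : _ * _ = C * (q `^ n%:R * q `^ (- (2 * n%:R)))); last first.
    by rewrite Mn_powR /C; ring.
  rewrite ler_wpM2l// -powR_MD//; apply: le_trans (powR_MN_le R M2 n).
  by apply: ler_powR_M => //; lra.
have H n : (0 <= n)%N -> measurable (F n) /\ (P (F n) <= (C * 2^-1 ^+ n)%:E)%E.
  by move=> _; split=> //; apply: bigsetU_measurable => i _.
apply: filterS (borel_cantelli_geometric H) => w [n1 h]; exists n1 => n nn i iM.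
rewrite leNgt; apply/negP => lt; apply: (h n nn).
rewrite /F -bigcup_mkord; exists i => //=; apply: le_lt_trans lt.
rewrite gridB// subSn// subnn div1r -powR_inv1 ?(ltW (Mn_gt0 R M2 n))// Mn_powR -!powRrM.
rewrite /lam -powR_MD//; apply: ler_powR_M => //; lra.
Qed.

End fbm_paths.

(** * Returns along the grid *)

Section fbm_returns.
Context (d : measure_display) (T : measurableType d) (R : realType)
  (P : probability T R) (alpha : R) (B : R -> {RV P >-> R}) (M : nat).
Hypotheses (alpha01 : 0 < alpha < 1)
  (fbmB : fractional_brownian_motion `[0, 1] alpha B) (M2 : (2 <= M)%N).
Notation q := (M%:R : R).

Section one_block.
Variables (n j i0 l p : nat) (eps : R).
Hypotheses (eps0 : 0 < eps) (i0l : (i0 + l <= M ^ n)%N) (lj : (l <= M ^ j)%N).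

Let r : R := q `^ (- (n%:R * (alpha - 2 * eps))).
Let x (s : seq nat) (i : nat) : R := grid R M n (i0 + nth 0%N (0%N :: s) i).
Let A (s : seq nat) : set T :=
  [set w | forall i, (i < p)%N -> `|B (x s i.+1) w - B (x s 0%N) w| <= r].

Let r0 : 0 < r. Proof. exact: powR_M_gt0. Qed.

Let K : R := fbm_ball_const alpha.

(* the bound of [fbm_small_ball] for one gap of [g] steps *)
Let w0 (g : nat) : R := (K * (r * q `^ (n%:R * alpha))) * g%:R `^ (- alpha).

Let mA s : measurable (A s).
Proof.
apply: (@measurable_small_ball _ _ _ p (fun i w => B (x s i.+1) w - B (x s 0%N) w)).
by move=> i; exact: measurable_funB.
Qed.

Lemma chain_event (s : seq nat) : s \in chains p 0 l ->
  (P (A s) <= (chain_weight w0 0 s)%:E)%E.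
Proof.
move=> /chains_spec[sz ps al].
have nl i : (i <= p)%N -> (nth 0 (0 :: s) i <= l)%N.
  case: i => [//|i] ip /=; rewrite -sz in ip.
  by move/(all_nthP 0%N) : al => /(_ i ip).
have inc i : (i < p)%N -> (nth 0 (0 :: s) i < nth 0 (0 :: s) i.+1)%N.
  by move=> ip; move/(pathP 0%N) : ps => /(_ i); rewrite sz => /(_ ip).
have [_ PA] := @fbm_small_ball _ _ _ _ _ _ alpha01 fbmB p (x s) r
  (fun i ip => grid01 R M2 (leq_trans (leq_add (leqnn i0) (nl i ip)) i0l))
  (fun i ip => grid_lt R M2 n (etrans (ltn_add2l i0 _ _) (inc i ip))) r0.
apply: le_trans PA _; rewrite lee_fin chain_weightE sz.
rewrite le_eqVlt; apply/orP; left; apply/eqP.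
apply: eq_bigr => i _; have ii := inc i (ltn_ord i).
rewrite /x gridB ?leq_add2l ?(ltnW ii)// subnDl /w0 -/K.
have g0 : (0 : R) < (nth 0 (0 :: s) i.+1 - nth 0 (0 :: s) i)%:R.
  by rewrite ltr0n subn_gt0.
rewrite powRM ?ler0n ?invr_ge0// Mn_powR -powRN -powRrM invfM -!powRN.
by rewrite mulNr opprK; ring.
Qed.

Let chain_count (w : T) : R := \sum_(s <- chains p 0 l) \1_(A s) w.

(** Hence the number of chains plays the part of a [p]-th moment of the number of
    returns. *)
Lemma chain_countE w : chain_count w =
  'C(returns M (fun t => B t w) n r i0 l, p)%:R.
Proof.
rewrite /returns -count_chains -sum1_count natr_sum [RHS]big_mkcond.
rewrite /chain_count; apply: eq_big_seq => s /chains_spec[sz ps al].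
rewrite indicE; set b := all _ _.
have -> : (w \in A s) = b.
  apply/idP/idP => [/set_mem h|/(all_nthP 0%N) h].
    apply/(all_nthP 0%N) => i; rewrite sz => ip.
    by have := h i ip; rewrite /x /= addn0.
  by apply/mem_set => i ip; rewrite /x /= addn0; apply: h; rewrite sz.
by case: b.
Qed.

Let z : R := q `^ (3 * eps * n%:R + j%:R * (1 - alpha)).

Let S : R := K / (1 - alpha) * q `^ (2 * eps * n%:R + j%:R * (1 - alpha)).

Lemma sum_chain_weight_le : \sum_(s <- chains p 0 l) chain_weight w0 0 s <= S ^+ p.
Proof.
have /andP[a0 a1] := alpha01.
have K0 : 0 < K by exact: fbm_ball_const_gt0.
have w00 g : 0 <= w0 g.
  by rewrite /w0 mulr_ge0 ?powR_ge0// mulr_ge0 ?(ltW K0)// mulr_ge0 ?powR_ge0 ?(ltW r0).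
apply: le_trans (sum_chain_weight p 0 w00 (leqnn l)) _.
apply: lerXn2r; rewrite ?nnegrE.
- by apply: sumr_ge0.
- by rewrite /S mulr_ge0 ?powR_ge0// divr_ge0 ?(ltW K0)//; lra.
rewrite /w0 -mulr_sumr.
have rq : r * q `^ (n%:R * alpha) = q `^ (2 * eps * n%:R).
  by rewrite /r -powR_MD//; congr (_ `^ _); ring.
rewrite rq /S powR_MD//.
have h := sum_powR_neg l a0 a1.
have c0 : 0 <= K * q `^ (2 * eps * n%:R) by rewrite mulr_ge0 ?powR_ge0 ?(ltW K0).
apply: le_trans (ler_wpM2l c0 h) _.
have lq : (l%:R : R) `^ (1 - alpha) <= q `^ (j%:R * (1 - alpha)).
  rewrite powRrM -Mn_powR; apply: ge0_ler_powR; rewrite ?nnegrE ?ler0n ?ler_nat//.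
  lra.
have -> : K / (1 - alpha) * (q `^ (2 * eps * n%:R) * q `^ (j%:R * (1 - alpha))) =
  K * q `^ (2 * eps * n%:R) * ((1 - alpha)^-1 * q `^ (j%:R * (1 - alpha))) by ring.
by rewrite ler_wpM2l// ler_wpM2l// invr_ge0; lra.
Qed.

Definition returns_const : R := p`!%:R * (2 * (K / (1 - alpha))) ^+ p.

(** Markov's inequality for the number of chains of length [p]. Up to a constant,
    the threshold [z] is larger than the expected contribution [S] of one step by
    the factor [q `^ (eps * n)], and this factor is won [p] times. *)
Lemma returns_tail : 2 * p%:R <= z ->
  exists E : set T, [/\ measurable E,
    (forall w, z < (returns M (fun t => B t w) n r i0 l)%:R -> E w) &
    (P E <= (returns_const * q `^ (- (eps * n%:R * p%:R)))%:E)%E].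
Proof.
move=> pz; have /andP[a0 a1] := alpha01.
have K0 : 0 < K by exact: fbm_ball_const_gt0.
have z0 : 0 < z by exact: powR_M_gt0.
have mN : measurable_fun setT chain_count.
  by apply: measurable_sum => s; exact: measurable_indic.
pose th : R := (z / 2) ^+ p / p`!%:R.
have pf : (0 : R) < p`!%:R by rewrite ltr0n fact_gt0.
have th0 : 0 < th by rewrite divr_gt0// exprn_gt0// divr_gt0.
pose E := [set w | th <= chain_count w].
have mE : measurable E.
  have mf : measurable_fun setT (fun w => th <= chain_count w).
    exact: measurable_fun_ler.
  by rewrite -[X in measurable X]setTI; exact: (mf measurableT [set true]).
exists E; split => //.
- move=> w; set Z := returns _ _ _ _ _ _ => zZ.
  rewrite /E /= chain_countE -/Z /th ler_pdivrMr// -natrM.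
  apply: le_trans (_ : ((Z - p) ^ p)%:R <= _); last by rewrite ler_nat bin_lower_bound.
  have pZ : (p <= Z)%N by rewrite -(ler_nat R); have := ler0n R p; lra.
  rewrite natrX natrB//; apply: lerXn2r; rewrite ?nnegrE.
  + by rewrite divr_ge0// ltW.
  + by rewrite subr_ge0 ler_nat.
  + lra.
- have N0 w : 0 <= chain_count w by apply: sumr_ge0.
  have H1 : (th%:E * P E <= \int[P]_w (chain_count w)%:E)%E.
    rewrite -[E]setIT -integral_indic// -ge0_integralZl//; last 2 first.
    - exact/measurable_EFinP/measurable_indic.
    - by rewrite lee_fin ltW.
    apply: ge0_le_integral => //.
    - by move=> w _; rewrite mule_ge0// lee_fin ltW.
    - by apply: measurable_funeM; exact/measurable_EFinP/measurable_indic.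
    - exact/measurable_EFinP.
    move=> w _; rewrite -EFinM lee_fin indicE.
    have [wE|_] := boolP (w \in E); last by rewrite mulr0.
    by rewrite mulr1; move/set_mem: wE.
  have H2 : (\int[P]_w (chain_count w)%:E <= (S ^+ p)%:E)%E.
    rewrite /chain_count; under eq_integral do rewrite -sumEFin.
    rewrite (@ge0_integral_sum _ _ _ P setT measurableT _ (fun s w => (\1_(A s) w)%:E))//; last first.
      by move=> s; exact/measurable_EFinP/measurable_indic.
    apply: (@le_trans _ _ (\sum_(s <- chains p 0 l) (chain_weight w0 0 s)%:E)%E).
      rewrite big_seq [leRHS]big_seq; apply: lee_sum => s sc.
      by rewrite integral_indic// setIT; exact: chain_event.
    by rewrite sumEFin lee_fin; exact: sum_chain_weight_le.
  have H3 := le_trans H1 H2.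
  rewrite -(@lee_pmul2l _ th%:E)// ?lte_fin//.
  apply: le_trans H3 _; rewrite -EFinM lee_fin le_eqVlt; apply/orP; left; apply/eqP.
  have e1 : S = (2 * (K / (1 - alpha))) * (z / 2) * q `^ (- (eps * n%:R)).
    rewrite /S (_ : 2 * eps * n%:R + j%:R * (1 - alpha) =
      (3 * eps * n%:R + j%:R * (1 - alpha)) + (- (eps * n%:R))); last by ring.
    by rewrite powR_MD// -/z; field; lra.
  have e2 (u v t : R) : (u * v * t) ^+ p = u ^+ p * v ^+ p * t ^+ p by rewrite !exprMn.
  rewrite e1 e2 /th /returns_const.
  have -> : q `^ (- (eps * n%:R)) ^+ p = q `^ (- (eps * n%:R * p%:R)).
    by rewrite -powR_mulrn ?powR_ge0// -powRrM mulNr.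
  by field; rewrite gt_eqF.
Qed.

End one_block.

Lemma powR_M_unbounded (c K : R) : 0 < c ->
  exists n0, forall n, (n0 <= n)%N -> K <= q `^ (c * n%:R).
Proof.
move=> c0; have q1 : 1 < q by rewrite ltr1n.
have cl : 0 < c * ln q by rewrite mulr_gt0// ln_gt0.
exists (Num.truncn (K / (c * ln q))).+1 => n nn.
rewrite /powR gt_eqF ?(M_gt0 R M2)//; apply: le_trans (expR_ge1Dx _).
have : K / (c * ln q) <= n%:R.
  by apply: le_trans (ltW (truncnS_gt _)) _; rewrite ler_nat.
rewrite ler_pdivrMr// => h; lra.
Qed.

(** There are at most [4 * q `^ (3 * n)] triples [(j, i0, l)], and the length of the
    chains is chosen so that [4 <= eps * p]. *)
Lemma fbm_returns (eps : R) : 0 < eps ->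
  {ae P, forall w, exists n0, forall n, (n0 <= n)%N -> forall j i0 l,
    (j <= n)%N -> (i0 + l <= M ^ n)%N -> (l <= M ^ j)%N ->
    (returns M (fun t => B t w) n (q `^ (- (n%:R * (alpha - 2 * eps)))) i0 l)%:R <=
      q `^ (3 * eps * n%:R + j%:R * (1 - alpha))}.
Proof.
move=> e0; have /andP[a0 a1] := alpha01.
pose p := (4 * (Num.truncn eps^-1).+1)%N.
have ep : 4 <= eps * p%:R.
  rewrite /p natrM mulrCA -[leLHS]mulr1 ler_wpM2l//.
  by rewrite -ler_pdivrMl// mulr1 ltW// truncnS_gt.
have [n0 n0P] : exists n0, forall n, (n0 <= n)%N -> 2 * p%:R <= q `^ (3 * eps * n%:R).
  by apply: powR_M_unbounded; rewrite mulr_gt0.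
pose C : R := returns_const p.
have C0 : 0 <= C.
  rewrite /C /returns_const mulr_ge0// exprn_ge0// mulr_ge0// divr_ge0//; last by lra.
  exact/ltW/fbm_ball_const_gt0.
pose rad n : R := q `^ (- (n%:R * (alpha - 2 * eps))).
pose zz n j : R := q `^ (3 * eps * n%:R + j%:R * (1 - alpha)).
pose good n j i0 l : set (set T) := [set E | [/\ measurable E,
    (forall w, zz n j < (returns M (fun t => B t w) n (rad n) i0 l)%:R -> E w) &
    (P E <= (C * q `^ (- (eps * n%:R * p%:R)))%:E)%E]].
pose E n j i0 l : set T := xget set0 (good n j i0 l).
pose cond n (t : 'I_n.+1 * ('I_(M ^ n).+1 * 'I_(M ^ n).+1)) :=
  (t.2.1 + t.2.2 <= M ^ n)%N && (t.2.2 <= M ^ t.1)%N.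
have goodE n j i0 l : (n0 <= n)%N -> (i0 + l <= M ^ n)%N -> (l <= M ^ j)%N ->
    good n j i0 l (E n j i0 l).
  move=> nn i0l lj; apply: xgetPex.
  apply: returns_tail => //; apply: le_trans (n0P n nn) _.
  by apply: ler_powR_M => //; rewrite lerDl mulr_ge0//; lra.
pose F n := \big[setU/set0]_(t | cond n t) E n t.1 t.2.1 t.2.2.
have HF n : (n0 <= n)%N -> measurable (F n) /\ (P (F n) <= (4 * C * 2^-1 ^+ n)%:E)%E.
  move=> nn; have mE t : cond n t -> measurable (E n t.1 t.2.1 t.2.2).
    by move=> /andP[c1 c2]; case: (goodE _ _ _ _ nn c1 c2).
  split; first exact: bigsetU_measurable.
  apply: le_trans (measure_finite_union _ _ mE) _.
  pose D : R := C * q `^ (- (4 * n%:R)).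
  have D0 : 0 <= D by rewrite mulr_ge0// powR_ge0.
  apply: (@le_trans _ _ (\sum_(t : 'I_n.+1 * ('I_(M ^ n).+1 * 'I_(M ^ n).+1)) D%:E)%E).
    rewrite big_mkcond; apply: lee_sum => t _; case: ifPn => [/andP[c1 c2]|_]; last by rewrite lee_fin.
    have [_ _ h] := goodE _ _ _ _ nn c1 c2; apply: le_trans h _.
    rewrite lee_fin ler_wpM2l//; apply: ler_powR_M => //.
    by have := ler_wpM2l (ler0n R n) ep; lra.
  rewrite sumEFin lee_fin sumr_const card_prod card_prod !card_ord -[_ *+ (n.+1 * _)]mulr_natl !natrM.
  have n2 : (n.+1%:R : R) <= q `^ n%:R.
    rewrite -Mn_powR ler_nat; apply: leq_trans (ltn_expl n (leqnn 2)) _.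
    by case: (n) => // k; rewrite leq_exp2r.
  have m2 : ((M ^ n).+1%:R : R) <= 2 * q `^ n%:R.
    rewrite -Mn_powR -natr1; have : (1 : R) <= (M ^ n)%:R by rewrite ler1n expn_gt0 (leq_trans _ M2).
    lra.
  have qn := powR_M_gt0 M2 (n%:R : R).
  apply: (@le_trans _ _ (q `^ n%:R * ((2 * q `^ n%:R) * (2 * q `^ n%:R)) * D)).
    by rewrite ler_wpM2r// ler_pM// ler_pM.
  rewrite (_ : _ * D = 4 * C * (q `^ n%:R * q `^ n%:R * q `^ n%:R * q `^ (- (4 * n%:R)))); last first.
    by rewrite /D; ring.
  apply: ler_wpM2l; first by rewrite mulr_ge0.
  rewrite -!powR_MD//; apply: le_trans (powR_MN_le R M2 n).
  by apply: ler_powR_M => //; lra.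
apply: filterS (borel_cantelli_geometric HF) => w [n1 h].
exists (maxn n0 n1) => n; rewrite geq_max => /andP[nn0 nn1] j i0 l jn i0l lj.
rewrite leNgt; apply/negP => lt; apply: (h n nn1).
have [_ hE _] := goodE _ _ _ _ nn0 i0l lj.
have {}hE := hE w lt.
have i0n : (i0 < (M ^ n).+1)%N by rewrite ltnS (leq_trans _ i0l)// leq_addr.
have ln : (l < (M ^ n).+1)%N by rewrite ltnS (leq_trans _ i0l)// leq_addl.
rewrite /F; pose t := (Ordinal (jn : (j < n.+1)%N), (Ordinal i0n, Ordinal ln)).
by rewrite (bigD1 t) /=; [left|rewrite /cond /= i0l lj].
Qed.

End fbm_returns.

(** * Oscillation on a mesh interval *)

Section oscillation.
Context (R : realType) (M : nat) (f : R -> R).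
Hypotheses (M2 : (2 <= M)%N) (cf : {within `[0, 1], continuous f}).
Notation q := (M%:R : R).
Notation gr := (grid R M).

Let index (x : R) (n : nat) : nat := Num.truncn (x * (M ^ n)%:R).

Let index_itv x n : 0 <= x ->
  (index x n)%:R <= x * (M ^ n)%:R < (index x n).+1%:R.
Proof. by move=> x0; apply: truncn_itv; rewrite mulr_ge0. Qed.

Let index_step x n : 0 <= x -> exists2 k, (k < M)%N & index x n.+1 = (M * index x n + k)%N.
Proof.
move=> x0; have /andP[l1 u1] := index_itv n x0; have /andP[l2 u2] := index_itv n.+1 x0.
rewrite expnS natrM mulrCA in l2 u2.
have h1 : (M * index x n < (index x n.+1).+1)%N.
  rewrite -(ltr_nat R) natrM; apply: le_lt_trans u2.
  by rewrite ler_wpM2l.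
have h2 : (index x n.+1 < M * (index x n).+1)%N.
  rewrite -(ltr_nat R) natrM; apply: le_lt_trans l2 _.
  by rewrite ltr_pM2l// M_gt0.
exists (index x n.+1 - M * index x n)%N; last by rewrite subnKC.
by rewrite ltn_subLR// addnC -mulnS.
Qed.

Let grid_refine n i : gr n i = gr n.+1 (M * i).
Proof.
rewrite /grid expnS !natrM -mulf_div divff ?mul1r// gt_eqF//.
exact: (M_gt0 R M2).
Qed.

Lemma mesh_interval_index n i x : mesh_interval M n i x -> (i < M ^ n)%N ->
  0 <= x < 1 /\ index x n = i.
Proof.
rewrite /mesh_interval /= => /andP[l u] iM.
have Mn := Mn_gt0 R M2 n.
have x0 : 0 <= x by apply: le_trans l; rewrite divr_ge0.
split.
  rewrite x0 /=; apply: lt_le_trans u _.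
  by rewrite ler_pdivrMr// mul1r ler_nat.
apply: truncn_def; rewrite -ler_pdivrMr// l /=.
by rewrite -ltr_pdivlMr.
Qed.

(** Chaining along the base-[M] expansion of a point; continuity is what allows to
    pass from grid points to arbitrary ones. *)
Lemma mesh_oscillation (a : R) (n0 : nat) : 0 < a ->
  (forall n, (n0 <= n)%N -> forall i, (i < M ^ n)%N ->
    `|f (gr n i.+1) - f (gr n i)| <= q `^ (- (n%:R * a))) ->
  exists2 C : R, 0 < C & forall n, (n0 <= n)%N -> forall i x, (i < M ^ n)%N ->
    mesh_interval M n i x -> `|f x - f (gr n i)| <= C * q `^ (- (n%:R * a)).
Proof.
move=> a0 H; pose rho : R := q `^ (- a).
have rho0 : 0 < rho by exact: powR_M_gt0.
have rhoX n : q `^ (- (n%:R * a)) = rho ^+ n.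
  by rewrite /rho -powR_mulrn ?powR_ge0// -powRrM mulNr mulrC.
have rho1 : rho < 1.
  rewrite /rho powRN invf_lt1 ?powR_M_gt0//.
  rewrite -[X in X < _](powRr0 q) /powR gt_eqF ?(M_gt0 R M2)// ltr_expR mul0r.
  by rewrite mulr_gt0// ln_gt0// ltr1n.
pose C := q * (1 - rho)^-1.
have r1 : 0 < 1 - rho by rewrite subr_gt0.
have C0 : 0 < C by rewrite mulr_gt0 ?invr_gt0 ?(M_gt0 R M2).
exists C => // n nn i x iM ix.
have [/andP[x0 x1] xi] := mesh_interval_index ix iM.
rewrite rhoX.
have ind_lt k : (index x k < M ^ k)%N.
  have /andP[l _] := index_itv k x0.
  rewrite -(ltr_nat R); apply: le_lt_trans l _.
  by rewrite -[ltRHS]mul1r ltr_pM2r ?(Mn_gt0 R M2).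
have walk k m j : (n0 <= k)%N -> (m + j <= M ^ k)%N ->
    `|f (gr k (m + j)) - f (gr k m)| <= j%:R * rho ^+ k.
  move=> nk; elim: j => [|j IH] mj; first by rewrite addn0 subrr normr0 mul0r.
  rewrite -(subrKA (f (gr k (m + j)))); apply: le_trans (ler_normD _ _) _.
  rewrite -natr1 mulrDl mul1r addrC lerD//.
    by apply: IH; apply: leq_trans mj; rewrite addnS.
  by rewrite addnS -rhoX; apply: H => //; rewrite -addnS.
have chain m : `|f (gr (n + m) (index x (n + m))) - f (gr n i)| <=
    q * \sum_(k < m) rho ^+ (n + k).
  elim: m => [|m IH]; first by rewrite addn0 xi subrr normr0 big_ord0 mulr0.
  rewrite big_ord_recr /= mulrDr.
  rewrite -(subrKA (f (gr (n + m) (index x (n + m))))).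
  apply: le_trans (ler_normD _ _) _; rewrite addrC lerD//.
  have [k kM] := index_step (n + m) x0; rewrite -addnS => ik.
  rewrite ik (grid_refine (n + m) (index x (n + m))) -addnS.
  apply: le_trans (walk _ _ _ _ _) _.
  - by rewrite (leq_trans nn)// leq_addr.
  - by rewrite -ik ltnW.
  - rewrite ler_pM ?exprn_ge0 ?(ltW rho0)// ?ler_nat ?(ltnW kM)//.
    by rewrite addnS exprS ler_piMl ?exprn_ge0 ?(ltW rho0)// ltW.
have bound m : `|f (gr (n + m) (index x (n + m))) - f (gr n i)| <= C * rho ^+ n.
  apply: le_trans (chain m) _; rewrite /C -mulrA ler_pM2l ?(M_gt0 R M2)//.
  under eq_bigr do rewrite exprD.
  rewrite -mulr_sumr mulrC ler_wpM2r ?exprn_ge0 ?(ltW rho0)//.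
  rewrite -[leRHS]div1r ler_pdivlMr// mulrC.
  have := subrX1 rho m => e.
  have -> : (1 - rho) * \sum_(k < m) rho ^+ k = 1 - rho ^+ m.
    by rewrite -[1 - rho]opprB mulNr -e opprB.
  by rewrite lerBlDr lerDl exprn_ge0// ltW.
apply/ler_addgt0Pr => e e0.
have xI : (`[0, 1]%classic : set R) x by rewrite /= in_itv/= x0 ltW.
have [del del0 hdel] : exists2 del : R, 0 < del &
    forall y, 0 <= y <= 1 -> `|x - y| < del -> `|f x - f y| < e.
  have /subspace_continuousP/(_ x xI)/cvgrPdist_lt/(_ e e0) := cf.
  move=> [del /= del0 h]; exists del => // y y01 xy.
  by apply: h => //=; rewrite in_itv/=.
have [m hm] : exists m, (M ^ (n + m))%:R^-1 < del.
  have [m hm] := powR_M_unbounded M2 (del^-1 + 1) ltr01.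
  exists m; rewrite invf_plt ?posrE ?(Mn_gt0 R M2)//.
  have := hm (n + m)%N (leq_addl _ _); rewrite mul1r -Mn_powR; lra.
have /andP[l u] := index_itv (n + m) x0.
rewrite -(subrKA (f (gr (n + m) (index x (n + m))))).
apply: le_trans (ler_normD _ _) _; rewrite addrC lerD//.
have Mn := Mn_gt0 R M2 (n + m).
apply/ltW/hdel; first exact/grid01/ltnW/ind_lt.
apply: le_lt_trans hm.
rewrite -ler_pdivrMr// in l; rewrite -ltr_pdivlMr// -natr1 mulrDl mul1r in u.
by rewrite ger0_norm /grid; lra.
Qed.

End oscillation.

(** * Counting mesh intervals across scales *)

Section counting.
Context (R : realType) (M : nat).
Hypothesis M2 : (2 <= M)%N.
Notation q := (M%:R : R).
Notation gr := (grid R M).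

Definition hits (A : set R) (n p : nat) : bool :=
  `[< @mesh_interval R M n p `&` A !=set0 >].

Definition oscillates (f : R -> R) (theta : R) (A : set R) (k p : nat) : bool :=
  `[< exists x y, [/\ A x, A y, @mesh_interval R M k p x,
        @mesh_interval R M k p y & theta < `|f x - f y|] >].

Lemma mesh_count_hits (A : set R) (n : nat) :
  mesh_count M n A = count (hits A n) (iota 0 (M ^ n)).
Proof.
rewrite /mesh_count -sum1_card -sum1_count -[X in iota 0 X]subn0.
by rewrite -/(index_iota _ _) big_mkord.
Qed.

Lemma count_blocks (h : pred nat) (K m : nat) :
  count h (iota 0 (K * m)) = (\sum_(Q < K) count h (iota (Q * m) m))%N.
Proof.
elim: K => [|K IH]; first by rewrite big_ord0.
by rewrite big_ord_recr /= mulSn addnC iotaD count_cat IH.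
Qed.

Lemma leq_count_in (a b : pred nat) (s : seq nat) :
  (forall i, i \in s -> a i -> b i) -> (count a s <= count b s)%N.
Proof.
elim: s => //= i s IH h; apply: leq_add.
  by have := h i (mem_head _ _); case: (a i) => //= ->.
by apply: IH => k ks; apply: h; rewrite inE ks orbT.
Qed.

Lemma mesh_interval_coarse (n j Q p : nat) : (j <= n)%N ->
  (Q * M ^ j <= p)%N -> (p < Q * M ^ j + M ^ j)%N ->
  @mesh_interval R M n p `<=` @mesh_interval R M (n - j) Q.
Proof.
move=> jn p1 p2 x; rewrite /mesh_interval /= => /andP[x1 x2].
have Mnj : (M ^ n = M ^ (n - j) * M ^ j)%N by rewrite -expnD subnK.
have e (a : nat) : a%:R / (M ^ (n - j))%:R = (a * M ^ j)%:R / (M ^ n)%:R :> R.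
  rewrite Mnj !natrM -mulf_div divff ?mulr1// gt_eqF//; exact: (Mn_gt0 R M2).
rewrite !e; apply/andP; split.
  by apply: le_trans x1; rewrite ler_pM2r ?invr_gt0 ?(Mn_gt0 R M2)// ler_nat.
apply: lt_le_trans x2 _; rewrite ler_pM2r ?invr_gt0 ?(Mn_gt0 R M2)// ler_nat.
by rewrite mulSn addnC.
Qed.

(** The first interval met in a block sees the other ones as returns. *)
Lemma count_hits_returns (f : R -> R) (A : set R) (n a m : nat) (r : R) (z : R) :
  (a + m <= M ^ n)%N ->
  (forall p p', (a <= p < a + m)%N -> (a <= p' < a + m)%N ->
     hits A n p -> hits A n p' -> `|f (gr n p') - f (gr n p)| <= r) ->
  (forall i0 l, (i0 + l <= M ^ n)%N -> (l <= m)%N -> (returns M f n r i0 l)%:R <= z) ->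
  0 <= z ->
  (count (hits A n) (iota a m))%:R <= 1 + z.
Proof.
move=> am close ret z0.
have [/hasP[p1 p1a hp1]|nh] := boolP (has (hits A n) (iota a m)); last first.
  have -> : count (hits A n) (iota a m) = 0%N.
    by apply/eqP; rewrite -leqn0 leqNgt -has_count.
  by rewrite addr_ge0.
rewrite mem_iota in p1a.
have ex : exists p, ((a <= p < a + m)%N && hits A n p) by exists p1; rewrite p1a.
case: (ex_minnP ex) => p /andP[/andP[ap pm] hp] pmin {p1 p1a hp1 ex}.
pose l := (a + m - p.+1)%N.
have E : iota a m = iota a (p - a) ++ p :: iota p.+1 l.
  have e2 : m = ((p - a) + l.+1)%N.
    by rewrite /l -subSn// subSS; move: ap pm; clear; lia.
  by rewrite [in LHS]e2 iotaD subnKC.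
rewrite E count_cat /= hp.
have -> : count (hits A n) (iota a (p - a)) = 0%N.
  apply/eqP; rewrite -leqn0 leqNgt -has_count; apply/hasPn => p'.
  rewrite mem_iota subnKC// => /andP[ap' pp']; apply/negP => hp'.
  by have := pmin p'; rewrite ap' (ltn_trans pp' pm) hp' /= leqNgt pp' => /(_ isT).
rewrite add0n natrD lerD2l.
apply: le_trans (ret p l _ _); last 2 first.
- by apply: leq_trans am; rewrite /l; move: ap pm; clear; lia.
- by rewrite /l; move: ap pm; clear; lia.
rewrite ler_nat /returns -[p.+1]addn1 iotaDl count_map.
apply: leq_count_in => i; rewrite mem_iota /= => /andP[i1 il] hi.
apply: close => //; first by rewrite ap.
by rewrite /l in il; move: ap pm i1 il; clear; lia.
Qed.

(** Compare the scales [n] and [n - j]. A coarse interval on which [f] varies little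
    over [A] contains few fine intervals meeting [A], by the bound on returns;
    for the other coarse intervals the trivial bound [M ^ j] is used. *)
Lemma mesh_count_recursion (f : R -> R) (alpha eps C : R) (n0 : nat) :
  0 < eps -> 0 < C ->
  (forall n, (n0 <= n)%N -> forall i x, (i < M ^ n)%N ->
    mesh_interval M n i x -> `|f x - f (gr n i)| <= C * q `^ (- (n%:R * (alpha - eps)))) ->
  (forall n, (n0 <= n)%N -> forall j i0 l,
    (j <= n)%N -> (i0 + l <= M ^ n)%N -> (l <= M ^ j)%N ->
    (returns M f n (q `^ (- (n%:R * (alpha - 2 * eps)))) i0 l)%:R <=
      q `^ (3 * eps * n%:R + j%:R * (1 - alpha))) ->
  (forall n, (n0 <= n)%N -> 1 + 2 * C <= q `^ (eps * n%:R)) -> alpha < 1 ->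
  forall A n j, (n0 <= n)%N -> (j <= n)%N ->
  (mesh_count M n A)%:R <=
   2 * q `^ (3 * eps * n%:R + j%:R * (1 - alpha)) * (mesh_count M (n - j) A)%:R +
   (count (oscillates f (q `^ (- (n%:R * alpha))) A (n - j)) (iota 0 (M ^ (n - j))))%:R
     * q `^ j%:R.
Proof.
move=> e0 C0 osc ret Cn a1 A n j nn jn.
set z := q `^ (3 * eps * n%:R + _).
set th := q `^ (- (n%:R * alpha)).
have z1 : 1 <= z.
  rewrite -[leLHS](powRr0 q); apply: ler_powR_M => //.
  by rewrite addr_ge0// mulr_ge0// ?mulr_ge0//; lra.
rewrite !mesh_count_hits.
rewrite (_ : M ^ n = M ^ (n - j) * M ^ j)%N; last by rewrite -expnD subnK.
rewrite count_blocks natr_sum.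
rewrite -!sum1_count -[X in iota 0 X]subn0 -/(index_iota _ _) !big_mkord !natr_sum.
rewrite mulr_sumr mulr_suml [X in _ <= X + _]big_mkcond [X in _ <= _ + X]big_mkcond /=.
rewrite -big_split /=.
apply: ler_sum => Q _.
have QM : (Q * M ^ j + M ^ j <= M ^ n)%N.
  have -> : (M ^ n = M ^ (n - j) * M ^ j)%N by rewrite -expnD subnK.
  rewrite addnC -mulSn leq_mul2r; apply/orP; right.
  exact: ltn_ord.
have small : ~~ oscillates f th A (n - j) Q -> hits A (n - j) Q ->
  (count (hits A n) (iota (Q * M ^ j) (M ^ j)))%:R <= 2 * z.
  move=> no _; apply: (@le_trans _ _ (1 + z)); last by lra.
  apply: (@count_hits_returns f A n _ _ (q `^ (- (n%:R * (alpha - 2 * eps))))) => //.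
  - move=> p p' /andP[p1 p2] /andP[p1' p2'] /asboolP[x [xp Ax]] /asboolP[x' [xp' Ax']].
    have pM : (p < M ^ n)%N by exact: leq_trans p2 QM.
    have pM' : (p' < M ^ n)%N by exact: leq_trans p2' QM.
    have o1 := osc n nn _ _ pM xp; have o2 := osc n nn _ _ pM' xp'.
    have o3 : `|f x' - f x| <= th.
      rewrite leNgt; apply/negP => lt; move/negP: no; apply; apply/asboolP.
      exists x', x; split => //.
      + exact: (mesh_interval_coarse jn p1' p2').
      + exact: (mesh_interval_coarse jn p1 p2).
    rewrite (_ : f (gr n p') - f (gr n p) = (f x' - f x) + ((f x - f (gr n p)) - (f x' - f (gr n p')))); last by ring.
    apply: le_trans (ler_normD _ _) _.
    apply: le_trans (lerD o3 (ler_normB _ _)) _.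
    have e : th <= q `^ (- (n%:R * (alpha - eps))).
      by apply: ler_powR_M => //; rewrite lerN2 ler_wpM2l//; lra.
    have -> : q `^ (- (n%:R * (alpha - 2 * eps))) =
        q `^ (eps * n%:R) * q `^ (- (n%:R * (alpha - eps))).
      by rewrite -powR_MD//; congr (_ `^ _); ring.
    have := Cn n nn; have := powR_M_gt0 M2 (- (n%:R * (alpha - eps))) => u0 h.
    apply: le_trans (ler_wpM2r (ltW u0) h); lra.
  - by move=> i0 l il lj; apply: ret.
  - lra.
have big : (count (hits A n) (iota (Q * M ^ j) (M ^ j)))%:R <= q `^ j%:R.
  by rewrite -Mn_powR ler_nat -[leqRHS](size_iota (Q * M ^ j)) count_size.
have empty : ~~ hits A (n - j) Q -> count (hits A n) (iota (Q * M ^ j) (M ^ j)) = 0%N.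
  move=> nh; apply/eqP; rewrite -leqn0 leqNgt -has_count; apply/hasPn => p.
  rewrite mem_iota => /andP[p1 p2]; apply/negP => /asboolP[x [xp Ax]].
  move/negP: nh; apply; apply/asboolP; exists x; split => //.
  exact: (mesh_interval_coarse jn p1 p2).
have qj := powR_ge0 q j%:R.
have [osc_Q|osc_Q] := boolP (oscillates f th A (n - j) Q); rewrite ?mul1r ?mul0r ?addr0.
  apply: le_trans big _; rewrite lerDr; case: ifP => _; rewrite ?mulr1 ?mulr0//; lra.
have [hit_Q|hit_Q] := boolP (hits A (n - j) Q); last by rewrite empty// mulr0.
by rewrite mulr1; exact: small.
Qed.

End counting.

(** * Growth of the counts and dimension *)

Section growth.
Context (R : realType) (M : nat).
Hypothesis M2 : (2 <= M)%N.
Notation q := (M%:R : R).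

(** Each step of the recursion goes from [n] to about [(1 - D^-1) * n] and gains the
    exponent [eta] on the gap, which beats both the factor [2] and the loss
    [3 * eps * n]; the inhomogeneous term only loses [n / D <= eta * n]. *)
Lemma growth_bound (N : nat -> R) (beta gamma V eta eps : R) (D n0 : nat) :
  (forall n, 0 <= N n) -> (0 < D)%N -> 0 < eta -> 0 <= beta <= gamma -> 0 <= V ->
  D%:R^-1 <= eta -> 3 * eps <= eta / (4 * D%:R) ->
  (forall n, (n0 <= n)%N ->
    N n <= 2 * q `^ (3 * eps * n%:R + (n %/ D)%:R * beta) * N (n - n %/ D)%N +
      V * q `^ (n%:R * gamma) * q `^ (n %/ D)%:R) ->
  exists2 C : R, 0 < C & forall n, N n <= C * q `^ (n%:R * (gamma + eta)).
Proof.
move=> N0 D0 eta0 /andP[b0 bg] V0 De ee rec.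
have DR : (0 : R) < D%:R by rewrite ltr0n.
pose c : R := eta / (4 * D%:R).
have c0 : 0 < c by rewrite divr_gt0// mulr_gt0.
have [n1 n1P] := powR_M_unbounded M2 (4 : R) c0.
pose n2 := maxn n0 (maxn n1 D).
pose C : R := 2 * V + 1 + \sum_(i < n2) N i.
have S0 : 0 <= \sum_(i < n2) N i by apply: sumr_ge0.
have C0 : 0 < C by rewrite /C; lra.
exists C => // n; have [k nk] := ubnP n; elim: k n nk => // k IH n nk.
have [nn|nn] := ltnP n n2.
  have h : N n <= \sum_(i < n2) N i.
    by rewrite (bigD1 (Ordinal nn))//= lerDl; apply: sumr_ge0.
  have q1 : 1 <= q `^ (n%:R * (gamma + eta)).
    by rewrite -[leLHS](powRr0 q); apply: ler_powR_M => //; rewrite mulr_ge0//; lra.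
  have : C <= C * q `^ (n%:R * (gamma + eta)) by rewrite ler_peMr// ltW.
  rewrite {1}/C; lra.
have [nn0 [nn1 nD]] : (n0 <= n)%N /\ (n1 <= n)%N /\ (D <= n)%N.
  by move: nn; rewrite /n2 !geq_max => /andP[-> /andP[-> ->]].
set j := (n %/ D)%N.
have j1 : (0 < j)%N by rewrite divn_gt0.
have jn : (j <= n)%N by exact: leq_div.
have jD : (j%:R : R) * D%:R <= n%:R by rewrite -natrM ler_nat; exact: leq_divM.
have nj : (n%:R : R) <= 2 * (j%:R * D%:R).
  rewrite -!natrM ler_nat; have := ltn_ceil n D0; rewrite -/j; move: j1; clear; nia.
have {}IH := IH (n - j)%N.
have {IH} : N (n - j)%N <= C * q `^ ((n - j)%:R * (gamma + eta)).
  by apply: IH; move: j1 jn nk; clear; lia.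
rewrite natrB// => IH.
apply: le_trans (rec n nn0) _; rewrite -/j.
have p0 x : 0 < q `^ x :> R by exact: powR_M_gt0.
have cj : 2 * c * n%:R <= j%:R * eta.
  rewrite (_ : 2 * c * n%:R = (eta / (2 * D%:R)) * n%:R); last by rewrite /c; field; rewrite gt_eqF.
  rewrite mulrAC ler_pdivrMr ?mulr_gt0//.
  by have := ler_wpM2l (ltW eta0) nj; lra.
have ej : j%:R <= n%:R * eta.
  have : j%:R <= n%:R / D%:R :> R by rewrite ler_pdivlMr.
  by have := ler_wpM2l (ler0n R n) De; lra.
have T1 : 2 * q `^ (3 * eps * n%:R + j%:R * beta) * N (n - j)%N <=
    2^-1 * (C * q `^ (n%:R * (gamma + eta))).
  apply: (@le_trans _ _ (2 * q `^ (3 * eps * n%:R + j%:R * beta) *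
      (C * q `^ ((n%:R - j%:R) * (gamma + eta))))).
    by rewrite ler_wpM2l// mulr_ge0// ltW.
  rewrite (_ : 2 * _ * _ = 2 * C * (q `^ (3 * eps * n%:R + j%:R * beta) *
     q `^ ((n%:R - j%:R) * (gamma + eta)))); last by ring.
  rewrite -powR_MD//.
  have le1 : q `^ (3 * eps * n%:R + j%:R * beta + (n%:R - j%:R) * (gamma + eta)) <=
      q `^ (n%:R * (gamma + eta)) * q `^ (- (c * n%:R)).
    rewrite -powR_MD//; apply: ler_powR_M => //.
    have := ler_wpM2r (ler0n R n) ee; rewrite -/c.
    by have := ler_wpM2l (ler0n R j) bg; lra.
  have le2 : q `^ (- (c * n%:R)) <= 4^-1.
    by rewrite powRN lef_pV2 ?posrE//; exact: n1P.
  have := ler_wpM2l (ltW (p0 (n%:R * (gamma + eta)))) le2 => le3.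
  have := ler_wpM2l (ltW C0) (le_trans le1 le3).
  by move: (q `^ _) (q `^ _) => u v; lra.
have T2 : V * q `^ (n%:R * gamma) * q `^ j%:R <= 2^-1 * (C * q `^ (n%:R * (gamma + eta))).
  rewrite -mulrA -powR_MD//.
  have le1 : q `^ (n%:R * gamma + j%:R) <= q `^ (n%:R * (gamma + eta)).
    by apply: ler_powR_M => //; lra.
  have VC : V <= 2^-1 * C by rewrite /C; lra.
  rewrite mulrA; apply: ler_pM => //; exact/ltW.
lra.
Qed.

Lemma upper_minkowski_dim_le (A : set R) (gamma : R) : 0 <= gamma ->
  (forall eta : R, 0 < eta -> exists2 C : R, 0 < C &
     forall n, (mesh_count M n A)%:R <= C * q `^ (n%:R * (gamma + eta))) ->
  (upper_minkowski_dim M A <= gamma%:E)%E.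
Proof.
move=> g0 H; apply/lee_addgt0Pr => e e0.
have e20 : 0 < e / 2 by rewrite divr_gt0.
have [C C0 HC] := H _ e20.
have lq : 0 < ln q by rewrite ln_gt0// ltr1n.
have q0 := M_gt0 R M2.
rewrite /upper_minkowski_dim limn_esup_lim; apply: lime_le; first exact: is_cvg_esups.
pose n0 := (Num.truncn (ln (C + 1) / (e / 2 * ln q))).+1.
exists n0 => // n /= nn0; apply: ge_ereal_sup => _ [k /= nk <-].
have k0 : (0 : R) < k%:R by rewrite ltr0n (leq_trans _ nk)// (leq_trans _ nn0).
rewrite -EFinD lee_fin ler_pdivrMr ?mulr_gt0//.
have kC : ln (C + 1) <= k%:R * (e / 2 * ln q).
  rewrite -ler_pdivrMr ?mulr_gt0//; apply: le_trans (ltW (truncnS_gt _)) _.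
  by rewrite ler_nat (leq_trans nn0).
have [->|N0] := posnP (mesh_count M k A).
  by rewrite ln0// !mulr_ge0//; lra.
have NR : (0 : R) < (mesh_count M k A)%:R by rewrite ltr0n.
apply: (@le_trans _ _ (ln ((C + 1) * q `^ (k%:R * (gamma + e / 2))))).
  rewrite ler_ln ?posrE//; last by rewrite mulr_gt0 ?powR_M_gt0//; lra.
  apply: le_trans (HC k) _; rewrite ler_wpM2r ?powR_ge0//; lra.
rewrite lnM ?posrE ?powR_M_gt0//; last by lra.
rewrite ln_powR; lra.
Qed.

End growth.

(** * Oscillating intervals *)

Section oscillating_intervals.
Context (R : realType) (M : nat).
Hypothesis M2 : (2 <= M)%N.
Notation q := (M%:R : R).

Lemma mesh_interval_dist (k Q : nat) (x y : R) :
  mesh_interval M k Q x -> mesh_interval M k Q y -> `|x - y| <= q `^ (- k%:R).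
Proof.
rewrite /mesh_interval /= powRN -Mn_powR => /andP[x1 x2] /andP[y1 y2].
rewrite -natr1 mulrDl mul1r in x2 y2.
by rewrite ler_norml; apply/andP; split; lra.
Qed.

(** A Hoelder exponent above [alpha] leaves room to work at the slightly coarser
    scale [n - n %/ D] and still vary by at most [q `^ (- (n * alpha))]. *)
Lemma holder_no_oscillation (alpha beta : R) (D : nat) (A : set R) (f : R -> R) :
  0 < beta -> (0 < D)%N -> alpha < (1 - D%:R^-1) * beta -> holder_on beta A f ->
  exists n0, forall n, (n0 <= n)%N -> forall Q,
    ~~ oscillates M f (q `^ (- (n%:R * alpha))) A (n - n %/ D) Q.
Proof.
move=> b0 D0 aD [c c0 Hc].
have d0 : 0 < (1 - D%:R^-1) * beta - alpha by rewrite subr_gt0.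
have [n0 n0P] := powR_M_unbounded M2 c d0.
exists n0 => n nn Q; apply/negP => /asboolP[x [y [Ax Ay xQ yQ]]].
apply/negP; rewrite -leNgt; apply: le_trans (Hc _ _ Ax Ay) _.
have xy := mesh_interval_dist xQ yQ.
set k := (n - n %/ D)%N in xy *.
have DR : (0 : R) < D%:R by rewrite ltr0n.
have kn : (n%:R : R) * (1 - D%:R^-1) <= k%:R.
  rewrite /k natrB ?leq_div// mulrBr mulr1 lerB// ler_pdivlMr// -natrM ler_nat.
  exact: leq_divM.
apply: (@le_trans _ _ (q `^ (((1 - D%:R^-1) * beta - alpha) * n%:R) * q `^ (- k%:R) `^ beta)).
  apply: ler_pM; rewrite ?powR_ge0 ?(ltW c0) ?n0P//.
  by apply: ge0_ler_powR; rewrite ?nnegrE ?powR_ge0 ?(ltW b0).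
rewrite -powRrM -powR_MD//; apply: ler_powR_M => //.
by have := ler_wpM2r (ltW b0) kn; lra.
Qed.

(** Visit the oscillating intervals from left to right, and one oscillating pair in
    each: every other increment along this path exceeds [theta]. *)
Lemma variation_oscillation (beta : R) (A : set R) (f : R -> R) : 0 < beta ->
  (power_variation beta A f < +oo)%E ->
  exists2 V : R, 0 <= V & forall k theta, 0 < theta ->
    (count (oscillates M f theta A k) (iota 0 (M ^ k)))%:R * theta `^ beta <= V.
Proof.
move=> b0 fin.
exists (Num.max 0 (fine (power_variation beta A f))); first by rewrite le_max lexx.
move=> k theta t0; set qs := [seq Q <- iota 0 (M ^ k) | oscillates M f theta A k Q].
rewrite -size_filter -/qs.
have [L0|L0] := posnP (size qs); first by rewrite L0 mul0r le_max lexx.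
(* an oscillating pair in increasing order *)
have pairs Q : exists xy : R * R, Q \in qs ->
    [/\ A xy.1, A xy.2, mesh_interval M k Q xy.1 /\ mesh_interval M k Q xy.2,
      xy.1 < xy.2 & theta < `|f xy.2 - f xy.1|].
  have [|nQ] := boolP (Q \in qs); last by exists (0, 0).
  rewrite mem_filter => /andP[/asboolP[x [y [Ax Ay xQ yQ lt]]] _].
  have [xy|yx|e] := ltgtP x y.
  - by exists (x, y) => _ /=; split => //; rewrite distrC.
  - by exists (y, x).
  - by move: lt; rewrite e subrr normr0 ltNge (ltW t0).
have [g gP] := choice pairs.
pose pt (i : nat) : R := let xy := g (nth 0%N qs i./2) in if odd i then xy.2 else xy.1.
have qs_in m : (m < size qs)%N -> nth 0%N qs m \in qs by move=> ?; exact: mem_nth.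
have qs_incr m : (m.+1 < size qs)%N -> (nth 0 qs m < nth 0 qs m.+1)%N.
  move=> mL; apply: (sorted_ltn_nth ltn_trans) => //; rewrite ?inE//; last exact: ltnW.
  by apply: sorted_filter; [exact: ltn_trans|exact: iota_ltn_sorted].
have Mk := Mn_gt0 R M2 k.
have pt_incr i : (i < (size qs).*2.-1)%N -> pt i < pt i.+1.
  move=> iL; have iL2 : (i./2 < size qs)%N by move: iL L0; clear; lia.
  rewrite /pt /=; have [oi|ei] := boolP (odd i); last first.
    rewrite uphalf_half (negbTE ei) add0n.
    by have [] := gP _ (qs_in _ iL2).
  rewrite uphalf_half oi add1n.
  have iL3 : (i./2.+1 < size qs)%N.
    by move: iL L0 (odd_double_half i); rewrite oi; clear; lia.
  have [_ _ [_ +] _ _] := gP _ (qs_in _ iL2).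
  have [_ _ [+ _] _ _] := gP _ (qs_in _ iL3).
  rewrite /mesh_interval /= => /andP[l _] /andP[_ u].
  apply: lt_le_trans u _; apply: le_trans l.
  by rewrite ler_pM2r ?invr_gt0// ler_nat qs_incr.
have ptA i : (i <= (size qs).*2.-1)%N -> A (pt i).
  move=> iL; have iL2 : (i./2 < size qs)%N by move: iL L0; clear; lia.
  by have [? ? _ _ _] := gP _ (qs_in _ iL2); rewrite /pt; case: ifP.
pose F i := `|f (pt i) - f (pt i.-1)| `^ beta.
have Fodd m : (m < size qs)%N -> theta `^ beta <= F m.*2.+1.
  move=> mL; rewrite /F /pt /= odd_double /= uphalf_double doubleK.
  have [_ _ _ _ lt] := gP _ (qs_in _ mL).
  by apply: ge0_ler_powR; rewrite ?nnegrE ?(ltW b0) ?(ltW t0) ?(ltW lt).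
have F0 i : 0 <= F i by exact: powR_ge0.
have sumF m : (m < size qs)%N -> m.+1%:R * theta `^ beta <= \sum_(1 <= i < m.+1.*2) F i.
  elim: m => [|m IH] mL.
    by rewrite big_nat1 mul1r; exact: (Fodd 0%N).
  rewrite [m.+2.*2]doubleS big_nat_recr//= big_nat_recr//= -[m.+2%:R]natr1 mulrDl mul1r.
  rewrite lerD ?Fodd//; apply: le_trans (IH (ltnW mL)) _.
  by rewrite lerDl.
rewrite le_max; apply/orP; right.
have := sumF (size qs).-1; rewrite prednK// => /(_ (leqnn _)) h.
apply: le_trans h _; rewrite -lee_fin.
have ub : ((\sum_(1 <= i < (size qs).*2) F i)%:E <= power_variation beta A f)%E.
  apply: ereal_sup_ubound; exists (size qs).*2.-1, pt; split => //.
    by move: L0; clear; lia.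
  by rewrite prednK// double_gt0.
rewrite fineK// fin_numElt fin andbT; apply: lt_le_trans ub; exact: ltNyr.
Qed.

End oscillating_intervals.

(** * Dimension of the sets where the path is regular *)

Section dimension_bound.
Context (R : realType) (M : nat) (alpha : R) (f : R -> R).
Hypotheses (M2 : (2 <= M)%N) (alpha01 : 0 < alpha < 1)
  (cf : {within `[0, 1], continuous f}).
Notation q := (M%:R : R).
Hypothesis increments : forall e : nat, exists n0, forall n, (n0 <= n)%N ->
  forall i, (i < M ^ n)%N ->
    `|f (grid R M n i.+1) - f (grid R M n i)| <= q `^ (- (n%:R * (alpha - e.+1%:R^-1))).
Hypothesis rare_returns : forall e : nat, exists n0, forall n, (n0 <= n)%N ->
  forall j i0 l, (j <= n)%N -> (i0 + l <= M ^ n)%N -> (l <= M ^ j)%N ->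
    (returns M f n (q `^ (- (n%:R * (alpha - 2 * e.+1%:R^-1)))) i0 l)%:R <=
      q `^ (3 * e.+1%:R^-1 * n%:R + j%:R * (1 - alpha)).

(** The two claims of the theorem only differ by the reason why few intervals
    oscillate. Since [D] is arbitrarily large, [few] is only asked for at scales
    arbitrarily close to [n]. *)
Lemma dimension_bound (A : set R) (gamma V : R) (D0 : nat) :
  1 - alpha <= gamma -> 0 <= V ->
  (forall D, (D0 <= D)%N -> (0 < D)%N -> exists n0, forall n, (n0 <= n)%N ->
     (count (oscillates M f (q `^ (- (n%:R * alpha))) A (n - n %/ D))
        (iota 0 (M ^ (n - n %/ D))))%:R <= V * q `^ (n%:R * gamma)) ->
  (upper_minkowski_dim M A <= gamma%:E)%E.
Proof.
move=> ag V0 few; have /andP[a0 a1] := alpha01.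
apply: (upper_minkowski_dim_le M2); first by lra.
move=> eta eta0.
pose D := maxn D0 (Num.truncn eta^-1).+1.
have Dpos : (0 < D)%N by rewrite /D leq_max orbT.
have DR : (0 : R) < D%:R by rewrite ltr0n.
have De : D%:R^-1 <= eta.
  rewrite invf_ple ?posrE//; apply: ltW; apply: lt_le_trans (truncnS_gt _) _.
  by rewrite ler_nat leq_max leqnn orbT.
have c0 : 0 < eta / (12 * D%:R) by rewrite divr_gt0// mulr_gt0.
pose e := maxn (Num.truncn (eta / (12 * D%:R))^-1) (Num.truncn (2 / alpha)).
pose eps : R := e.+1%:R^-1.
have eps0 : 0 < eps by rewrite invr_gt0.
have e1 : eps <= eta / (12 * D%:R).
  rewrite /eps invf_ple ?posrE//; apply: ltW; apply: lt_le_trans (truncnS_gt _) _.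
  by rewrite ler_nat ltnS leq_maxl.
have e2 : eps < alpha.
  rewrite /eps invf_plt ?posrE//; apply: lt_le_trans (_ : (Num.truncn (2 / alpha)).+1%:R <= _).
    apply: le_lt_trans (truncnS_gt _).
    by rewrite ler_peMl ?invr_ge0 ?(ltW a0)// ler1n.
  by rewrite ler_nat ltnS leq_maxr.
have ae0 : 0 < alpha - eps by rewrite subr_gt0.
have [n1 n1P] := increments e.
have [C C0 n1C] := mesh_oscillation M2 cf ae0 n1P.
have [n2 n2P] := rare_returns e.
have [n3 n3P] := powR_M_unbounded M2 (1 + 2 * C) eps0.
have [n4 n4P] := few D (leq_maxl _ _) Dpos.
pose n0 := maxn (maxn n1 n2) (maxn n3 n4).
have n0P n : (n0 <= n)%N -> [/\ (n1 <= n)%N, (n2 <= n)%N, (n3 <= n)%N & (n4 <= n)%N].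
  by rewrite /n0 !geq_max => /andP[/andP[? ?] /andP[? ?]].
have rec := @mesh_count_recursion R M M2 f alpha eps C n0 eps0 C0
  (fun n h => let: And4 h1 _ _ _ := n0P n h in n1C n h1)
  (fun n h => let: And4 _ h2 _ _ := n0P n h in n2P n h2)
  (fun n h => let: And4 _ _ h3 _ := n0P n h in n3P n h3) a1 A.
apply: (@growth_bound R M M2 (fun n => (mesh_count M n A)%:R) (1 - alpha) gamma V eta eps D n0) => //.
- by rewrite ag andbT subr_ge0 ltW.
- apply: le_trans (ler_wpM2l _ e1) _ => //.
  by rewrite le_eqVlt; apply/orP; left; apply/eqP; field; rewrite gt_eqF.
- move=> n nn; apply: le_trans (rec n (n %/ D)%N nn (leq_div _ _)) _.
  have [_ _ _ nn4] := n0P n nn.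
  by rewrite lerD2l ler_wpM2r ?powR_ge0//; exact: n4P.
Qed.

End dimension_bound.

Theorem theorem2p10 (d : measure_display) (T : measurableType d)
    (R : realType) (P : probability T R) (alpha : R) (B : R -> {RV P >-> R})
    (M : nat) :
  0 < alpha -> alpha < 1 ->
  fractional_brownian_motion `[0, 1] alpha B ->
  (2 <= M)%N ->
  {ae P, forall w, forall A : set R, A `<=` `[0, 1] ->
    ((exists2 beta : R, alpha < beta & holder_on beta A (fun t => B t w)) ->
       (upper_minkowski_dim M A <= (1 - alpha)%:E)%E)
    /\
    (forall beta : R, 0 < beta ->
       (power_variation beta A (fun t => B t w) < +oo)%E ->
       (upper_minkowski_dim M A <= (Num.max (1 - alpha) (alpha * beta))%:E)%E)}.
Proof.
move=> a0 a1 fbmB M2.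
have a01 : 0 < alpha < 1 by rewrite a0.
have [_ _ _ _ contB] := fbmB.
have incr (e : nat) := fbm_grid_increments fbmB M2
  (ltac:(by rewrite invr_gt0) : (0 : R) < e.+1%:R^-1).
have ret (e : nat) := fbm_returns a01 fbmB M2
  (ltac:(by rewrite invr_gt0) : (0 : R) < e.+1%:R^-1).
have incr' := ae_foralln incr; have ret' := ae_foralln ret.
move: contB; apply: filterS3 incr' ret' => w incw retw contw A _.
have bound := dimension_bound M2 a01 contw incw retw.
split.
- move=> [beta ab hold]; have b0 : 0 < beta by lra.
  pose D0 := (Num.truncn (beta / (beta - alpha))).+1.
  apply: (bound A _ 0 D0) => // D DD Dpos.
  have DR : (0 : R) < D%:R by rewrite ltr0n.
  have bD : beta / D%:R < beta - alpha.
    rewrite ltr_pdivrMr// mulrC -ltr_pdivrMr ?subr_gt0//.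
    by apply: lt_le_trans (truncnS_gt _) _; rewrite ler_nat.
  have aD : alpha < (1 - D%:R^-1) * beta by rewrite mulrBl mul1r mulrC; lra.
  have [n0 n0P] := holder_no_oscillation M2 b0 Dpos aD hold.
  exists n0 => n nn; rewrite mul0r.
  rewrite (_ : count _ _ = 0%N)//; apply/eqP; rewrite -leqn0 leqNgt -has_count.
  by apply/hasPn => Q _; exact: n0P.
- move=> beta b0 var.
  have [V V0 HV] := variation_oscillation M2 b0 var.
  apply: (bound A _ V 1%N) => //; first by rewrite le_max lexx.
  move=> D _ _; exists 0%N => n _.
  have th := powR_M_gt0 M2 (- (n%:R * alpha)).
  have thb : (M%:R : R) `^ (- (n%:R * alpha)) `^ beta =
      (M%:R `^ (n%:R * alpha * beta))^-1 by rewrite -powRrM mulNr powRN.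
  have := HV (n - n %/ D)%N _ th.
  rewrite thb ler_pdivrMr ?powR_M_gt0// => h.
  apply: le_trans h _; rewrite ler_wpM2l//; apply: ler_powR_M => //.
  by rewrite -mulrA ler_wpM2l// le_max lexx orbT.
Qed.
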